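(* Let $p>5$ be a prime. If $p\equiv 5,7\pmod 8$, then $$\sum_{k=0}^{p-1}\frac{\binom{2k}{k}\binom{3k}{k}\binom{6k}{3k}}{20^{3k}}\equiv 0\pmod{p^2}.$$ If $p\equiv 1,3\pmod 8$ and so $p=c^2+2d^2$ with $c,d\in\mathbb{Z}$, then $$\sum_{k=0}^{p-1}\frac{\binom{2k}{k}\binom{3k}{k}\binom{6k}{3k}}{20^{3k}}\equiv \left(\frac{-5}{p}\right)4c^2\pmod p.$$
   Context: $\left(\frac{a}{p}\right)$ denotes the Legendre symbol. Congruences modulo $p$ and $p^2$ are in the ring of rational numbers whose denominator is coprime to $p$. *)

(* Defs.v *)
From mathcomp Require Import all_boot all_order all_algebra.
Set Implicit Arguments.
Unset Strict Implicit.
Unset Printing Implicit Defensive.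
Import GRing.Theory.
Local Open Scope ring_scope.

(* The ring Z_(p) of rationals whose denominator is coprime to p. *)
Definition plocal (p : nat) (x : rat) : bool := coprime p `|denq x|%N.

(* x = y modulo the ideal n Z_(p). *)
Definition eqmod_plocal (p n : nat) (x y : rat) : Prop :=
  [/\ plocal p x, plocal p y & exists2 z : rat, plocal p z & x - y = n%:R * z].

(* Only meaningful for p an odd prime. *)
Definition legendre (a : int) (p : nat) : int :=
  if (p %| a)%Z then 0
  else if [exists x : 'I_p, (x%:Z ^+ 2 == a %[mod p])%Z] then 1 else -1.

Definition binom_sum (p : nat) : rat :=
  \sum_(0 <= k < p)
    ('C(2 * k, k) * 'C(3 * k, k) * 'C(6 * k, 3 * k))%N%:R / 20%:R ^+ (3 * k).

(* Main.v *)
Require Import Defs.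
From mathcomp Require Import all_boot all_order all_algebra all_solvable all_field.
From mathcomp Require Import zify ring.
Set Implicit Arguments.
Unset Strict Implicit.
Unset Printing Implicit Defensive.
Import Order.TTheory GRing.Theory Num.Theory.
Local Open Scope ring_scope.

(** Write u_k = C(6k,3k) C(3k,k), a_k = C(2k,k) u_k and m = (p-1)/2, so that the
sum in question is S = sum_(k < p) a_k / 8000^k.

The power series sum u_k x^k solves a hypergeometric equation of order two, and
Clausen's formula says that its square is sum a_k (x (1 - 432 x))^k
([clausen]).  Cut at degree p, the two sides still agree modulo p^2, because
every coefficient of degree at least p is divisible by p^2 on either side
([clausen_trunc]).  With x = (1 - t) / 864 the argument x (1 - 432 x) becomes
(1 - t^2) / 1728, which is 1/8000 when t^2 = 98/125.  This value need not be a
square; but if the polynomial sum_(k < p) u_k x^k is split into its even part E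
and odd part O as a polynomial in t, then S = E(98/125)^2 + (98/125) O(98/125)^2
modulo p^2 ([apoly_value]).

Modulo p the truncated series is, up to the sign of 3^m, the sum over x in F_p of
(x^3 - 3x + 2t)^m, the Hasse invariant of the elliptic curve
y^2 = x^3 - 3x + 2t ([upoly_hasse]).  At t^2 = 98/125 this curve is a twist by the
square root of 10 of y^2 = x^3 - 30x + 56, that is of y^2 = x (x^2 + 4x + 2), which
has complex multiplication by the square root of -2.  Because the Hasse
invariant is isobaric in the two coefficients of the cubic, the twist only
contributes a factor 10^m to its square, and S = 10^m B^2 modulo p, where B is the
Brewer sum of the Legendre symbols of (x + 2)(x^2 - 2) ([upoly_t_value_sq]).

It remains to know B.  The curve has an isogeny of degree two onto its own twist
by -2, so B vanishes when -2 is not a square, i.e. for p = 5, 7 mod 8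
([brewer_sum_eq0]); then E and O vanish modulo p and S vanishes modulo p^2.
(For p = 7 the odd part need not vanish, but 98/125 is divisible by 49.)  When
p = 1, 3 mod 8 the integer B/2 is the first coordinate c of a representation
p = c^2 + 2 d^2 ([brewer_sum_repr]).  This is Jacobsthal's method: B is half
of a sum over a torus (the multiplicative group of F_p when p = 1 mod 8, the
quotient of that of F_(p^2) by that of F_p when p = 3 mod 8), a quarter of that
sum, namely c = B/2, belongs to a family indexed by quartic twists, the sum of the
squares over the whole family can be computed by expanding, and the four twist
classes contribute c^2, d^2, 0, d^2.  Finally c^2 is determined by p ([repr_x2_2y2_uniq]), and
10^m = (-5)^m (-2)^m = (-5)^m. *)

(** * The quadratic character *)

(** Taking the exponent m as a parameter lets the same character be used on a
field with 2m+1 elements and on the copy of that field inside an extension. *)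
Definition quad_char (K : idomainType) (m : nat) (x : K) : int :=
  if x == 0 then 0 else if x ^+ m == 1 then 1 else -1.

Section ChiIdomain.
Variables (K : idomainType) (m : nat).
Hypothesis two_neq0 : 2 != 0 :> K.
Local Notation chi := (quad_char m).
Implicit Types x y : K.

Lemma oneN1 : (1 == -1 :> K) = false.
Proof. by apply/negbTE; move: two_neq0; apply: contra => /eqP h; apply/eqP; rewrite -[2]/(1 + 1) {1}h addNr. Qed.

Lemma chi0 : chi (0 : K) = 0.
Proof. by rewrite /quad_char eqxx. Qed.

Lemma chi1 : chi (1 : K) = 1.
Proof. by rewrite /quad_char oner_eq0 expr1n eqxx. Qed.

Lemma euler_pm x : x ^+ m.*2.+1 = x -> x != 0 -> x ^+ m = 1 \/ x ^+ m = -1.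
Proof.
move=> xK x0; have : (x ^+ m) ^+ 2 = 1.
  by apply: (mulfI x0); rewrite mulr1 -exprM muln2 -exprS.
by move/eqP; rewrite sqrf_eq1 => /orP[] /eqP ->; [left | right].
Qed.

Lemma chi_euler x : x ^+ m.*2.+1 = x -> (0 < m)%N -> (chi x)%:~R = x ^+ m.
Proof.
move=> xK m0; rewrite /quad_char; case: eqP => [->|/eqP x0].
  by rewrite expr0n; case: m m0.
case: (euler_pm xK x0) => ->; first by rewrite eqxx.
by rewrite eq_sym oneN1.
Qed.

Lemma chiM x y : x ^+ m.*2.+1 = x -> y ^+ m.*2.+1 = y ->
  chi (x * y) = chi x * chi y.
Proof.
move=> xK yK; rewrite /quad_char mulf_eq0; case: eqP => [|/eqP x0] /=; first by rewrite mul0r.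
case: eqP => [|/eqP y0]; first by rewrite mulr0.
rewrite exprMn; have n1 : (-1 == 1 :> K) = false by rewrite eq_sym oneN1.
by case: (euler_pm xK x0) => ->; case: (euler_pm yK y0) => ->;
  rewrite ?mulrNN ?mulr1 ?mul1r ?eqxx ?n1 ?mulrNN.
Qed.

Lemma chi_sq x : x ^+ m.*2.+1 = x -> x != 0 -> chi x ^+ 2 = 1.
Proof.
by move=> xK x0; rewrite /quad_char (negbTE x0); case: eqP.
Qed.

Lemma chi_sqr x : x ^+ m.*2.+1 = x -> x != 0 -> chi (x ^+ 2) = 1.
Proof. by move=> xK x0; rewrite expr2 chiM // -expr2 chi_sq. Qed.

End ChiIdomain.

(** * Primitive elements of finite fields *)

Section Generator.
Variable K : finFieldType.

Lemma finField_generator : exists g : K,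
  #|K|.-1.-primitive_root g /\ (forall x, x != 0 -> exists2 i, (i < #|K|.-1)%N & x = g ^+ i).
Proof.
have K1 : (1 < #|K|)%N by exact: finNzRing_gt1.
have K0 : (0 < #|K|.-1)%N by lia.
have ex x : x != 0 :> K -> x ^+ #|K|.-1 = 1.
  move=> x0; apply: (mulfI x0).
  by rewrite -exprS prednK ?(ltnW K1) // expf_card mulr1.
pose rs := [seq x <- enum K | x != 0].
have : has #|K|.-1.-primitive_root rs.
  apply: has_prim_root => //.
  - by apply/allP => x; rewrite mem_filter => /andP[x0 _]; apply/unity_rootP; apply: ex.
  - by rewrite filter_uniq ?enum_uniq.
  - rewrite size_filter -(@leq_add2r 1) addn1 prednK ?(ltnW K1) //.
    rewrite cardE -(count_predC (fun x : K => x != 0)) leq_add2l.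
    rewrite (eq_count (a2 := pred1 0)) ?count_uniq_mem ?enum_uniq // ?leq_b1 //.
    by move=> x /=; rewrite negbK.
case/hasP=> g _ gp; exists g; split=> // x x0.
by case: (prim_rootP gp (ex _ x0)) => i ->; exists (i : nat); rewrite ?ltn_ord.
Qed.

Lemma sum_powers (g : K) (f : K -> int) : #|K|.-1.-primitive_root g ->
  \sum_(x | x != 0) f x = \sum_(i < #|K|.-1) f (g ^+ i).
Proof.
move=> gp; have K1 : (1 < #|K|)%N by exact: finNzRing_gt1.
have g0 : g != 0.
  apply/eqP => g0; have := prim_expr_order gp; rewrite g0 expr0n.
  have -> : (#|K|.-1 == 0)%N = false by lia.
  by move/eqP; rewrite eq_sym oner_eq0.
have perm : perm_eq [seq x <- enum K | x != 0] (mkseq (GRing.exp g) #|K|.-1).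
  apply: uniq_perm; first by rewrite filter_uniq ?enum_uniq.
    rewrite map_inj_in_uniq ?iota_uniq // => a b; rewrite !mem_iota => ha hb /eqP.
    by rewrite (eq_prim_root_expr gp) !modn_small; [move/eqP | lia ..].
  move=> x; rewrite mem_filter mem_enum andbT; apply/idP/mapP => [x0|[i _ ->]].
    have [i ->]: {i : 'I_#|K|.-1 | x = g ^+ i}.
      apply: (prim_rootP gp); apply: (mulfI x0).
      by rewrite -exprS prednK ?(ltnW K1) // expf_card mulr1.
    by exists (i : nat); rewrite // mem_iota ltn_ord.
  by rewrite expf_neq0.
rewrite -(big_filter _ (fun x => x != 0)) -[index_enum K]enumT (perm_big _ perm) big_map.
by rewrite -[X in iota _ X]subn0 big_mkord.
Qed.

End Generator.

(** * Quadratic character sums *)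

Section QuadraticSums.
Variables (K : finFieldType) (m : nat).
Hypotheses (cardK : #|K| = m.*2.+1) (two_neq0 : 2 != 0 :> K).
Local Notation chi := (quad_char m).
Implicit Types (x y : K) (h : K -> int).

Lemma exp_card_odd x : x ^+ m.*2.+1 = x.
Proof. by rewrite -cardK expf_card. Qed.

Lemma half_card_gt0 : (0 < m)%N.
Proof. by have := finNzRing_gt1 K; rewrite cardK; lia. Qed.

Lemma quad_chiM x y : chi (x * y) = chi x * chi y.
Proof. by rewrite chiM ?exp_card_odd. Qed.

Lemma quad_chi_sqr x : x != 0 -> chi (x ^+ 2) = 1.
Proof. by move=> x0; rewrite chi_sqr ?exp_card_odd. Qed.

Lemma quad_chi_eq_sqr x y z : z != 0 -> x = y * z ^+ 2 -> chi x = chi y.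
Proof. by move=> z0 ->; rewrite quad_chiM quad_chi_sqr // mulr1. Qed.

Lemma chi_generator (g : K) i : #|K|.-1.-primitive_root g -> chi (g ^+ i) = (-1) ^+ i.
Proof.
move=> gp; have g0 : g != 0.
  apply/eqP => g0; have := prim_expr_order gp; rewrite g0 expr0n cardK /=.
  have -> : (m.*2 == 0)%N = false by have := half_card_gt0; lia.
  by move/eqP; rewrite eq_sym oner_eq0.
rewrite /quad_char expf_eq0 (negbTE g0) andbF -exprM -(prim_order_dvd gp) cardK /=.
rewrite -muln2 [(i * m)%N]mulnC dvdn_pmul2l ?half_card_gt0 // dvdn2.
by rewrite -signr_odd; case: (odd i).
Qed.

Lemma chi_has_sqrt x : chi x = 1 -> exists y, y ^+ 2 = x.
Proof.
have [g [gp gs]] := finField_generator K.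
have [->|x0] := eqVneq x 0; first by rewrite chi0.
have [i _ ->] := gs x x0; rewrite (chi_generator _ gp) -signr_odd => oi.
have ei : odd i = false by move: oi; case: (odd i).
by exists (g ^+ i./2); rewrite -exprM muln2 even_halfK ?ei.
Qed.

Lemma chi_values x : x != 0 -> chi x = 1 \/ chi x = -1.
Proof. by move=> x0; rewrite /quad_char (negbTE x0); case: eqP; [left | right]. Qed.

Lemma sum_sqrt x : \sum_(y | y ^+ 2 == x) (1 : int) = 1 + chi x.
Proof.
have [->|x0] := eqVneq x 0.
  rewrite chi0 (eq_bigl (pred1 0)) ?big_pred1_eq // => y.
  by rewrite /= expf_eq0.
case: (chi_values x0) => cx; last first.
  rewrite cx big_pred0 // => y; apply/eqP => e; move: cx; rewrite -e quad_chi_sqr //.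
  by apply: contra x0 => /eqP y0; rewrite -e y0 expr0n.
have [y ye] := chi_has_sqrt cx.
have y0 : y != 0 by apply: contra x0 => /eqP y0; rewrite -ye y0 expr0n.
have yNy : - y != y.
  apply: contra y0; rewrite -subr_eq0 -opprD oppr_eq0 -mulr2n -mulr_natl.
  by rewrite mulf_eq0 (negbTE two_neq0).
rewrite cx (bigD1 y) ?ye //= (bigD1 (- y)) /=; last by rewrite sqrrN ye eqxx.
rewrite big_pred0 ?addr0 // => z; rewrite -ye eqf_sqr -andbA.
by case: eqP => //= _; rewrite andbN.
Qed.

Lemma sum_over_squares h : \sum_y h (y ^+ 2) = \sum_x (1 + chi x) * h x.
Proof.
rewrite (partition_big (fun y => y ^+ 2) xpredT) //=; apply: eq_bigr => x _.
rewrite -sum_sqrt big_distrl /=; apply: eq_bigr => y /eqP ->.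
by rewrite mul1r.
Qed.

Lemma sum_chi : \sum_(x : K) chi x = 0.
Proof.
have := sum_over_squares (fun _ => 1); under [RHS]eq_bigr do rewrite mulr1.
rewrite big_split /= => e.
by apply: (addrI (\sum_(x : K) (1 : int))); rewrite addr0 [RHS]e.
Qed.

Lemma sum_shift h (a : K) : \sum_x h (x + a) = \sum_x h x.
Proof. by symmetry; rewrite (reindex_inj (addIr a)). Qed.

Lemma sum_scale h (a : K) : a != 0 -> \sum_x h (a * x) = \sum_x h x.
Proof. by move=> a0; symmetry; rewrite (reindex_inj (mulfI a0)). Qed.

Lemma sum_opp h : \sum_x h (- x) = \sum_x h x.
Proof. by symmetry; rewrite (reindex_inj (@oppr_inj K)). Qed.

Lemma sum_inv h : \sum_(x | x != 0) h x^-1 = \sum_(x | x != 0) h x.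
Proof.
by symmetry; rewrite (reindex_inj (@invr_inj K)); apply: eq_bigl => x; rewrite invr_eq0.
Qed.

(** For c nonzero, chi (x (x + c)) = chi (1 + c / x), and 1 + c / x runs through
every value but 1. *)
Lemma sum_chi_split_quadratic (a b : K) :
  \sum_x chi ((x + a) * (x + b)) = if a == b then (m.*2)%:Z else -1.
Proof.
rewrite -(sum_shift _ (- b)).
under eq_bigr => x _ do rewrite -!addrA addNr addr0.
set c := - b + a; have -> : (a == b) = (c == 0) by rewrite /c addrC subr_eq0.
rewrite (bigD1 0) //= mulr0 chi0 add0r.
transitivity (\sum_(x | x != 0) chi (1 + c * x)).
  rewrite -[RHS]sum_inv; apply: eq_bigr => x x0.
  by apply: (quad_chi_eq_sqr x0); field.
case: eqP => [->|/eqP c0].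
  under eq_bigr do rewrite mul0r addr0 chi1.
  rewrite sumr_const.
  have -> : #|[pred x : K | x != 0]| = m.*2.
    by rewrite (eq_card (B := predC1 0)) // cardC1 cardK.
  by rewrite -mulr_natl mulr1 natz.
apply: (addrI (chi (1 + c * 0))).
rewrite -(bigD1 (P := xpredT) (F := fun x => chi (1 + c * x)) 0) //=.
rewrite (sum_scale (fun x => chi (1 + x))) //.
under eq_bigr do rewrite addrC.
by rewrite sum_shift sum_chi mulr0 addr0 chi1.
Qed.

(** The equation x + b / x = u is quadratic in x with discriminant u^2 - 4b, which
gives the size of the fibre over u. *)
Lemma sum_over_joukowski h (b : K) : b != 0 ->
  \sum_(x | x != 0) h (x + b / x) = \sum_u (1 + chi (u ^+ 2 - 4 * b)) * h u.
Proof.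
move=> b0; rewrite (partition_big (fun x => x + b / x) xpredT) //=; apply: eq_bigr => u _.
rewrite -sum_sqrt big_distrl /=.
have four_neq0 : 4 != 0 :> K by rewrite -[4]/((2 * 2)%:R) natrM mulf_neq0.
rewrite (reindex (fun y => (y + u) / 2)) /=; last first.
  by exists (fun x => x * 2 - u) => x _; field.
apply: eq_big => [y|y /andP[_ /eqP ->]]; last by rewrite mul1r.
have [/eqP y0|y0] := boolP ((y + u) / 2 == 0).
  have -> : y = - u.
    by move/eqP: y0; rewrite mulf_eq0 invr_eq0 (negbTE two_neq0) orbF addr_eq0 => /eqP.
  rewrite /= sqrrN; symmetry; apply/negbTE; rewrite eq_sym -subr_eq0 addrC addKr.
  by rewrite oppr_eq0 mulf_neq0.
have yu0 : y + u != 0 by apply: contra y0 => /eqP ->; rewrite mul0r.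
rewrite /= -(inj_eq (mulIf yu0)) -subr_eq0 -[RHS]subr_eq0.
rewrite -[RHS](inj_eq (mulfI (_ : 2^-1 != 0))) ?invr_eq0 // mulr0; congr (_ == 0).
by field; rewrite two_neq0 yu0.
Qed.

End QuadraticSums.

(** * Sums along a cyclic group *)

Lemma sum_periodic (F : nat -> int) M c : (forall i, F (i + M)%N = F i) ->
  \sum_(i < c * M) F i = c%:Z * \sum_(i < M) F i.
Proof.
move=> per; elim: c => [|c IH]; first by rewrite mul0n big_ord0 mul0r.
have perc i : F (c * M + i)%N = F i.
  by elim: (c) => [|d IHd]; rewrite ?mul0n // mulSn -addnA addnC per.
rewrite -(big_mkord xpredT) mulSnr (@big_cat_nat _ _ _ (c * M)) ?leq_addr //= big_mkord IH.
rewrite -{1}[(c * M)%N]add0n big_addn addKn.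
rewrite (eq_bigr F) => [|i _]; last by rewrite addnC perc.
by rewrite big_mkord -[in RHS]addn1 PoszD mulrDl mul1r.
Qed.

Lemma sum_antiperiodic4_sq (F : nat -> int) M : (forall i, F (i + 4)%N = - F i) ->
  F 2%N = 0 -> F 3%N = F 1%N ->
  \sum_(i < M * 4) F i ^+ 2 = M%:Z * (F 0%N ^+ 2 + 2 * F 1%N ^+ 2).
Proof.
move=> per F2 F3; rewrite (@sum_periodic (fun i => F i ^+ 2)) => [|i]; last by rewrite per sqrrN.
by rewrite !big_ord_recl big_ord0 /= /bump /= F2 F3; ring.
Qed.

(** * The Brewer sum and the quartic Jacobsthal sums *)

Section Brewer.
Variables (K : finFieldType) (m : nat).
Hypotheses (cardK : #|K| = m.*2.+1) (two_neq0 : 2 != 0 :> K).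
Local Notation chi := (quad_char m).
Implicit Types (x y : K) (h : K -> int).

(** The quotient of y^2 = x (x^2 + a x + b) by the two-torsion point (0, 0) has
coordinate u = x + b / x, and isogenous curves have as many points. *)
Lemma sum_chi_two_isogeny (a b : K) : b != 0 ->
  \sum_x chi (x * (x ^+ 2 + a * x + b)) = \sum_u chi ((u + a) * (u ^+ 2 - 4 * b)).
Proof.
move=> b0; rewrite (bigD1 0) //= mul0r chi0 add0r.
transitivity (\sum_(x | x != 0) chi ((x + b / x) + a)).
  by apply: eq_bigr => x x0; apply: (quad_chi_eq_sqr cardK two_neq0 x0); field.
rewrite (sum_over_joukowski cardK two_neq0 (fun u => chi (u + a)) b0).
under [LHS]eq_bigr => u _ do rewrite mulrDl mul1r -quad_chiM //.
rewrite big_split /= (sum_shift (fun x => chi x)) sum_chi // add0r.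
by apply: eq_bigr => u _; rewrite mulrC.
Qed.

Definition brewer_sum : int := \sum_(x : K) chi ((x + 2) * (x ^+ 2 - 2)).

Lemma sum_chi_brewer_shift : \sum_(x : K) chi (x * (x ^+ 2 - 4 * x + 2)) = brewer_sum.
Proof.
rewrite -(sum_shift _ 2); apply: eq_bigr => x _; congr chi; ring.
Qed.

Lemma chi_opp x : chi (- x) = chi (-1 : K) * chi x.
Proof. by rewrite -quad_chiM // mulN1r. Qed.

Lemma sum_chi_brewer_shift_opp :
  \sum_(x : K) chi (x * (x ^+ 2 + 4 * x + 2)) = chi (-1 : K) * brewer_sum.
Proof.
rewrite -sum_chi_brewer_shift big_distrr /= -sum_opp; apply: eq_bigr => x _.
by rewrite -chi_opp; congr chi; ring.
Qed.

Lemma chi8 : chi (8 : K) = chi (2 : K).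
Proof. by apply: (quad_chi_eq_sqr cardK two_neq0 two_neq0); ring. Qed.

(** For y^2 = x (x^2 + 4x + 2) the two-isogenous curve is the original one twisted by
-2: this is complex multiplication by the square root of -2. *)
Lemma brewer_sum_twist : chi (-2 : K) * brewer_sum = brewer_sum.
Proof.
have := sum_chi_two_isogeny 4 two_neq0; rewrite sum_chi_brewer_shift_opp.
rewrite -(sum_scale _ two_neq0) => e.
have {}e : chi (-1 : K) * brewer_sum = chi (2 : K) * brewer_sum.
  rewrite e -chi8 big_distrr /=; apply: eq_bigr => x _; rewrite -quad_chiM //; congr chi.
  by ring.
have n1 : chi (-1 : K) * chi (-1 : K) = 1.
  by rewrite -quad_chiM // mulrNN mulr1 chi1.
by rewrite chi_opp -mulrA -e mulrA n1 mul1r.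
Qed.

Lemma brewer_sum_eq0 : chi (-2 : K) = -1 -> brewer_sum = 0.
Proof. by move=> c; have := brewer_sum_twist; rewrite c; lia. Qed.

Definition jacobsthal (k : K) : int := \sum_y chi (y * (y ^+ 4 + k)).

(** With u = y + 1/y one has (u + 2) (u^2 - 2) = (y + 1)^2 (y^4 + 1) / y^3.  Each u
is hit 1 + chi (u^2 - 4) times, and u -> -u turns the part weighted by
chi (u^2 - 4) into the Brewer sum again. *)
Lemma jacobsthal_brewer : jacobsthal 1 = (1 + chi (-1 : K)) * brewer_sum.
Proof.
have n1 : -1 != 0 :> K by rewrite oppr_eq0 oner_eq0.
have := sum_over_joukowski cardK two_neq0 (fun u => chi ((u + 2) * (u ^+ 2 - 2))) (oner_neq0 K).
under [RHS]eq_bigr do rewrite mulrDl mul1r -quad_chiM //.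
rewrite big_split /= -/brewer_sum => e.
have L : \sum_(y : K | y != 0) chi ((y + 1 / y + 2) * ((y + 1 / y) ^+ 2 - 2)) =
    jacobsthal 1 - chi (-2 : K).
  have -> : jacobsthal 1 = chi (-2 : K) +
      \sum_(y : K | (y != 0) && (y != -1)) chi (y * (y ^+ 4 + 1)).
    rewrite /jacobsthal (bigD1 0) //= mul0r chi0 add0r (bigD1 (-1)) //=.
    by congr (chi _ + _); ring.
  rewrite addrAC subrr add0r [LHS](bigD1 (-1)) //=.
  rewrite [X in quad_char _ (X * _)](_ : _ = 0); last by field.
  rewrite mul0r chi0 add0r; apply: eq_bigr => y /andP[y0 y1].
  have y10 : y + 1 != 0 by rewrite addr_eq0.
  symmetry; apply: (@quad_chi_eq_sqr _ _ cardK two_neq0 _ _ (y ^+ 2 / (y + 1))).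
    by rewrite mulf_neq0 ?invr_eq0 ?expf_neq0.
  by field; rewrite y0 y10.
have R : \sum_(u : K) chi ((u ^+ 2 - 4 * 1) * ((u + 2) * (u ^+ 2 - 2))) =
    chi (-1 : K) * brewer_sum - chi (-2 : K).
  have -> : chi (-1 : K) * brewer_sum = chi (-2 : K) +
      \sum_(u : K | u != -2) chi (-1 : K) * chi ((- u + 2) * ((- u) ^+ 2 - 2)).
    rewrite /brewer_sum big_distrr /= -sum_opp (bigD1 (-2)) //=; congr (_ + _).
    by rewrite -quad_chiM //; apply: (quad_chi_eq_sqr cardK two_neq0 two_neq0); ring.
  rewrite addrAC subrr add0r [LHS](bigD1 (-2)) //= addNr mul0r mulr0 chi0 add0r.
  apply: eq_bigr => u u2.
  rewrite -quad_chiM //; apply: (@quad_chi_eq_sqr _ _ cardK two_neq0 _ _ (u + 2)).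
    by rewrite addr_eq0.
  by ring.
by move: e; rewrite L R; lia.
Qed.

Lemma jacobsthal_scale (a k : K) : a != 0 -> jacobsthal (a ^+ 4 * k) = chi a * jacobsthal k.
Proof.
move=> a0; rewrite /jacobsthal -(sum_scale _ a0) big_distrr /=; apply: eq_bigr => y _.
rewrite -quad_chiM //; apply: (@quad_chi_eq_sqr _ _ cardK two_neq0 _ _ (a ^+ 2)); last by ring.
by rewrite expf_neq0.
Qed.

Lemma jacobsthal_inv (k : K) : k != 0 -> jacobsthal k = chi k * jacobsthal k^-1.
Proof.
move=> k0; rewrite /jacobsthal ![\sum_y _](bigD1 0) //= !mul0r chi0 !add0r big_distrr -sum_inv /=.
apply: eq_bigr => y y0.
rewrite -quad_chiM //; apply: (@quad_chi_eq_sqr _ _ cardK two_neq0 _ _ (y ^- 3)).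
  by rewrite invr_eq0 expf_neq0.
by field; rewrite y0 k0.
Qed.

(** Up to a factor 4, theta is the family of Jacobsthal sums.  Multiplying k by a
fourth power g^4 changes the sign, inverting k relates the classes of g and g^3 and
kills that of g^2, and the second moment over all k is elementary; together they
give #|K| = theta(1)^2 + 2 theta(g)^2. *)
Lemma brewer_sum_split f : m = (4 * f)%N ->
  exists c d : int, [/\ #|K|%:Z = c ^+ 2 + 2 * d ^+ 2 & brewer_sum = 2 * c].
Proof.
move=> mE; have [g [gp gs]] := finField_generator K.
pose M := (2 * f)%N; have cM : #|K|.-1 = (4 * M)%N by rewrite cardK mE /M; lia.
have g0 : g != 0.
  apply/eqP => g0; have := prim_expr_order gp; rewrite g0 expr0n cM /=.
  have -> : (4 * M == 0)%N = false by have := half_card_gt0 cardK; rewrite /M; lia.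
  by move/eqP; rewrite eq_sym oner_eq0.
have gM : g ^+ (4 * M) = 1 by rewrite -cM prim_expr_order.
pose theta k := \sum_(j < M) (-1) ^+ j * chi (k + g ^+ (4 * j)).
have chig i : chi (g ^+ i) = (-1) ^+ i by rewrite (chi_generator cardK two_neq0).
have phiE k : jacobsthal k = 4 * theta k.
  rewrite /jacobsthal (bigD1 0) //= mul0r chi0 add0r (sum_powers _ gp) cM.
  rewrite (@sum_periodic (fun i => chi (g ^+ i * ((g ^+ i) ^+ 4 + k)))) => [|i].
    by congr (_ * _); apply: eq_bigr => j _; rewrite quad_chiM // chig addrC -exprM mulnC.
  rewrite !quad_chiM // !chig -!exprM mulnDl [(M * 4)%N]mulnC [g ^+ (_ + _ * _)]exprD gM mulr1.
  by rewrite exprD /M exprM sqrrN !expr1n mulr1.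
(* M is even, so the alternating signs cancel. *)
have sgn0 : \sum_(j < M) (-1) ^+ j = 0 :> int.
  rewrite /M mulnC (@sum_periodic (fun j => (-1) ^+ j)) => [|i].
    by rewrite !big_ord_recl big_ord0 /= expr0 expr1 addr0 subrr mulr0.
  by rewrite exprD sqrrN expr1n mulr1.
have M0 : (0 < M)%N by have := half_card_gt0 cardK; rewrite /M; lia.
have th4 i : theta (g ^+ (i + 4)) = - theta (g ^+ i).
  have := jacobsthal_scale (g ^+ i) g0; rewrite -exprD addnC !phiE.
  by have := chig 1%N; rewrite !expr1 => ->; lia.
have thM i j : theta (g ^+ (i + 4 * j)) = (-1) ^+ j * theta (g ^+ i).
  elim: j => [|j IH]; first by rewrite muln0 addn0 expr0 mul1r.
  by rewrite mulnS [(4 + _)%N]addnC addnA th4 IH exprS mulN1r mulNr.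
have thinv i : (i <= 4 * M)%N -> theta (g ^+ i) = (-1) ^+ i * theta (g ^+ (4 * M - i)).
  move=> iM; have := jacobsthal_inv (expf_neq0 i g0); rewrite !phiE chig.
  have -> : (g ^+ i)^-1 = g ^+ (4 * M - i).
    by apply: (mulfI (expf_neq0 i g0)); rewrite mulfV ?expf_neq0 // -exprD subnKC.
  by move: (theta _) (theta _) ((-1) ^+ i) => a b c; lia.
have M1 : (-1) ^+ M.-1 = -1 :> int.
  by rewrite -signr_odd; have -> : odd M.-1 by rewrite /M; lia.
have th2 : theta (g ^+ 2) = 0.
  have := thinv 2%N (ltac:(lia)); have -> : (4 * M - 2 = 2 + 4 * M.-1)%N by lia.
  by rewrite thM M1 sqrrN expr1n; move: (theta _) => a; lia.
have th3 : theta (g ^+ 3) = theta (g ^+ 1).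
  have := thinv 1%N (ltac:(lia)); have -> : (4 * M - 1 = 3 + 4 * M.-1)%N by lia.
  by rewrite thM M1 (expr1 (-1 : int)) !mulN1r opprK => ->.
have moment : \sum_k theta k ^+ 2 = (M * m.*2.+1)%:Z.
  under eq_bigr => k _ do rewrite expr2 big_distrlr /=.
  rewrite exchange_big /=.
  transitivity (\sum_(i < M) \sum_(j < M)
     ((if j == i then m.*2.+1%:Z else 0) - (-1) ^+ i * (-1) ^+ j) : int).
    apply: eq_bigr => i _; rewrite exchange_big /=; apply: eq_bigr => j _.
    transitivity ((-1) ^+ i * (-1) ^+ j * \sum_k chi ((k + g ^+ (4 * i)) * (k + g ^+ (4 * j)))).
      by rewrite big_distrr; apply: eq_bigr => k _; rewrite quad_chiM //= mulrACA.
    rewrite (sum_chi_split_quadratic cardK) // (eq_prim_root_expr gp) cM.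
    rewrite !modn_small ?ltn_pmul2l // eqn_pmul2l //.
    have -> : (i == j :> nat) = (j == i) by rewrite eq_sym.
    case: eqP => [->|_]; last by rewrite sub0r mulrN1.
    rewrite -expr2 -exprM muln2 -mul2n exprM sqrrN !expr1n; lia.
  under eq_bigr => i _ do rewrite big_split /= -big_mkcond big_pred1_eq.
  rewrite big_split /= sumr_const card_ord.
  under [X in _ + X]eq_bigr => i _ do rewrite sumrN -big_distrr /= sgn0 mulr0 oppr0.
  by rewrite big1 // addr0 -mulr_natl natz PoszM.
have th0 : theta 0 = 0.
  rewrite /theta (eq_bigr (fun j : 'I_M => (-1) ^+ j)) // => j _.
  by rewrite add0r chig exprM -signr_odd /= expr1n mulr1.
move: moment; rewrite (bigD1 0) //= th0 expr0n add0r (sum_powers _ gp) cM mulnC.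
rewrite (@sum_antiperiodic4_sq (fun i => theta (g ^+ i))) // => e.
exists (theta 1), (theta (g ^+ 1)); split.
  rewrite cardK; apply: (mulfI (_ : M%:Z != 0)); last by rewrite -PoszM -e expr0.
  by lia.
have := phiE 1; rewrite jacobsthal_brewer.
have -> : chi (-1 : K) = 1.
  rewrite /quad_char oppr_eq0 oner_eq0 mE exprM -signr_odd /=.
  by rewrite expr1n eqxx.
lia.
Qed.

(** The sextic (s^2 + 1) (s^4 - 6 s^2 + 1) is half the binary form z z' (z^4 + z'^4)
in the coordinates z = s + i, z' = s - i.  In w = s^2 the sum splits into one over
(w + 1) (w^2 - 6w + 1) and one over w (w + 1) (w^2 - 6w + 1); affine, respectively
fractional linear, substitutions turn both into Brewer sums. *)
Lemma sum_chi_octahedral :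
  \sum_(s : K) chi ((s ^+ 2 + 1) * (s ^+ 4 - 6 * s ^+ 2 + 1)) = 2 * (chi (2 : K) * brewer_sum) - 1.
Proof.
pose h (w : K) := chi ((w + 1) * (w ^+ 2 - 6 * w + 1)).
transitivity (\sum_s h (s ^+ 2)).
  by apply: eq_bigr => s _; rewrite /h -exprM.
have four_neq0 : 4 != 0 :> K by rewrite -[4]/((2 * 2)%:R) natrM mulf_neq0.
rewrite (sum_over_squares cardK two_neq0); under eq_bigr => w _ do rewrite mulrDl mul1r /h -quad_chiM //.
rewrite big_split /=.
have -> : \sum_(w : K) chi ((w + 1) * (w ^+ 2 - 6 * w + 1)) = chi (2 : K) * brewer_sum.
  rewrite -(sum_shift _ (-1)) -(sum_scale _ two_neq0) -sum_chi_brewer_shift big_distrr /=.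
  apply: eq_bigr => x _; rewrite -quad_chiM //.
  by apply: (quad_chi_eq_sqr cardK two_neq0 two_neq0); ring.
suff -> : \sum_(w : K) chi (w * ((w + 1) * (w ^+ 2 - 6 * w + 1))) = chi (2 : K) * brewer_sum - 1.
  by ring.
rewrite -(sum_shift _ (-1)) (bigD1 0) //= add0r addNr mul0r mulr0 chi0 add0r -sum_inv /=.
transitivity (\sum_(v : K | v != 0) chi ((1 - v) * (1 - 8 * v + 8 * v ^+ 2))).
  apply: eq_bigr => v v0; apply: (@quad_chi_eq_sqr _ _ cardK two_neq0 _ _ (v ^- 2)).
    by rewrite invr_eq0 expf_neq0.
  by field.
have -> : chi (2 : K) * brewer_sum = \sum_(v : K) chi ((1 - v) * (1 - 8 * v + 8 * v ^+ 2)).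
  rewrite -sum_opp -(sum_shift _ (-1)) -(sum_scale _ (_ : 4^-1 != 0)) ?invr_eq0 //.
  rewrite -sum_chi_brewer_shift big_distrr /=; apply: eq_bigr => x _; rewrite -quad_chiM //.
  by apply: (quad_chi_eq_sqr cardK two_neq0 four_neq0); field.
rewrite [in RHS](bigD1 0) //= subr0 mulr0 expr0n mulr0 subr0 addr0 mulr1 chi1.
by rewrite addrAC subrr add0r.
Qed.

End Brewer.

(** * Primes congruent to 3 modulo 8 *)

Section QuadraticExtension.
Variables (p m : nat).
Hypotheses (p_prime : prime p) (pE : p = m.*2.+1).

Lemma cardFp_odd : #|'F_p| = m.*2.+1.
Proof. by rewrite card_Fp. Qed.

Lemma half_prime_gt0 : (0 < m)%N.
Proof. by move: p_prime; rewrite pE; case: m. Qed.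

Lemma two_neq0_Fp : 2 != 0 :> 'F_p.
Proof.
rewrite -(dvdn_pcharf (pchar_Fp p_prime)) gtnNdvd // pE.
by have := half_prime_gt0; lia.
Qed.

Variables (F : finFieldType) (iota : {rmorphism 'F_p -> F}).
Hypothesis cardF : #|F| = (p ^ 2)%N.

Lemma two_neq0_ext : 2 != 0 :> F.
Proof. by rewrite -(rmorph_nat iota) fmorph_eq0 two_neq0_Fp. Qed.

Lemma pchar_ext : p \in [pchar F].
Proof. exact: (rmorph_pchar iota (pchar_Fp p_prime)). Qed.

Lemma frobD (x y : F) : (x + y) ^+ p = x ^+ p + y ^+ p.
Proof. exact: (rmorphD (pFrobenius_aut pchar_ext) x y). Qed.

Lemma frobK (x : F) : (x ^+ p) ^+ p = x.
Proof. by rewrite -exprM mulnn -cardF expf_card. Qed.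

Lemma iota_frob a : iota a ^+ p = iota a.
Proof. by have := expf_card a; rewrite card_Fp // -rmorphXn => ->. Qed.

Lemma chi_iota a : quad_char m (iota a) = quad_char m a.
Proof. by rewrite /quad_char fmorph_eq0 -rmorphXn fmorph_eq1. Qed.

(** The polynomial X^p - X already has the p elements of the prime field as roots. *)
Lemma frob_fixed (x : F) : x ^+ p = x -> exists a, x = iota a.
Proof.
move=> xp; case: (boolP (x \in codom iota)) => [/codomP[a ->]|xn]; first by exists a.
have p1 := prime_gt1 p_prime.
have X0 : 'X^p - 'X != 0 :> {poly F}.
  by rewrite -size_poly_eq0 size_polyDl ?size_polyXn // size_polyN size_polyX.
have := max_poly_roots X0 (_ : all _ (x :: codom iota)) (_ : uniq (x :: codom iota)).
rewrite size_polyDl ?size_polyXn ?size_polyN ?size_polyX //= size_codom card_Fp // ltnn.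
move=> h; exfalso; suff: false by []; apply: h.
  rewrite /root !hornerE xp subrr eqxx /=.
  by apply/allP => _ /codomP[a ->]; rewrite /root !hornerE iota_frob subrr.
by rewrite xn map_inj_uniq ?enum_uniq //; apply: fmorph_inj.
Qed.

Definition field_norm (z : F) := z ^+ p.+1.
Definition field_trace (z : F) := z + z ^+ p.

Lemma field_norm_fixed z : field_norm z ^+ p = field_norm z.
Proof. by rewrite /field_norm -exprM mulnC exprM exprSr frobK exprS. Qed.

Lemma field_trace_fixed z : field_trace z ^+ p = field_trace z.
Proof. by rewrite /field_trace frobD frobK addrC. Qed.

Lemma field_traceM a z : a ^+ p = a -> field_trace (a * z) = a * field_trace z.
Proof. by move=> ap; rewrite /field_trace exprMn ap mulrDr. Qed.

Lemma field_traceD y z : field_trace (y + z) = field_trace y + field_trace z.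
Proof. by rewrite /field_trace frobD; ring. Qed.

Local Notation chiF := (@quad_char F m).

Lemma chi_fixedM (x y : F) : x ^+ p = x -> y ^+ p = y -> chiF (x * y) = chiF x * chiF y.
Proof. by rewrite pE => *; apply: chiM => //; apply: two_neq0_ext. Qed.

(** If w is a primitive eighth root of unity, then w + w^3 is a square root of -2, and
Frobenius fixes or negates it according to p modulo 8. *)
Lemma chi_m2 : quad_char m (-2 : 'F_p) = if (p %% 8 < 4)%N then 1 else -1.
Proof.
have [g [gp gs]] := finField_generator F.
have m0 := half_prime_gt0.
have [n cn] : exists n, #|F|.-1 = (8 * n)%N.
  have [c mc] : exists c, (m * m.+1 = 2 * c)%N.
    by exists (m * m.+1)./2; rewrite mul2n even_halfK // oddM /=; case: (odd m).
  by exists c; rewrite cardF pE; lia.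
have n0 : (0 < n)%N by move: cn; rewrite cardF pE; nia.
have w4 : (g ^+ n) ^+ 4 = -1.
  have : (g ^+ n) ^+ 4 != 1.
    by rewrite -exprM -(prim_order_dvd gp) cn gtnNdvd //; lia.
  have : ((g ^+ n) ^+ 4) ^+ 2 == 1.
    by rewrite -!exprM -(prim_order_dvd gp) cn; apply/dvdnP; exists 1%N; lia.
  by rewrite sqrf_eq1 => /orP[/eqP ->|/eqP -> //]; rewrite eqxx.
move: (g ^+ n) w4 => w w4; pose d := w + w ^+ 3.
have d2 : d ^+ 2 = -2.
  transitivity (w ^+ 2 + 2 * w ^+ 4 + w ^+ 2 * w ^+ 4); first by rewrite /d; ring.
  by rewrite w4; ring.
have d0 : d != 0.
  by apply/eqP => d0; move/eqP: d2; rewrite d0 expr0n eq_sym oppr_eq0 (negbTE two_neq0_ext).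
have dm : d * (-2) ^+ m = d ^+ p by rewrite -d2 -exprM mul2n -exprS pE.
have w8 k : w ^+ (8 * k) = 1 by rewrite exprM (exprM w 4 2) w4 sqrrN !expr1n.
have wp : w ^+ p = w ^+ (p %% 8).
  by rewrite {1}(divn_eq p 8) exprD mulnC w8 mul1r.
have dp : d ^+ p = (if (p %% 8 < 4)%N then 1 else -1) * d.
  rewrite frobD exprAC wp.
  have : [\/ p %% 8 = 1, p %% 8 = 3, p %% 8 = 5 | p %% 8 = 7]%N.
    have : odd p by rewrite pE; lia.
    move=> op; have := ltn_pmod p (isT : 0 < 8)%N; have := modn_dvdm p (isT : 2 %| 8)%N.
    rewrite !modn2 op; case: (p %% 8)%N => [|[|[|[|[|[|[|[|]]]]]]]] //= _ _;
    by [constructor 1 | constructor 2 | constructor 3 | constructor 4].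
  rewrite /d; case=> -> /=.
  - by ring.
  - by transitivity (w ^+ 3 + w * w ^+ 4 * w ^+ 4); [ring | rewrite w4; ring].
  - by transitivity (w * w ^+ 4 + w ^+ 3 * w ^+ 4 * w ^+ 4 * w ^+ 4); [ring | rewrite w4; ring].
  - by transitivity (w ^+ 3 * w ^+ 4 + w * w ^+ 4 * w ^+ 4 * w ^+ 4 * w ^+ 4 * w ^+ 4); [ring | rewrite w4; ring].
rewrite -chi_iota rmorphN rmorph_nat /quad_char oppr_eq0 (negbTE two_neq0_ext).
have -> : (-2 : F) ^+ m = if (p %% 8 < 4)%N then 1 else -1.
  by apply: (mulfI d0); rewrite dm dp mulrC.
by case: (_ < _)%N; rewrite ?eqxx // [-1 == 1 :> F]eq_sym (oneN1 two_neq0_ext).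
Qed.

Section Inert.
Variable f : nat.
Hypothesis mE : m = (4 * f + 1)%N.

Lemma generator_data : exists g i : F,
  [/\ #|F|.-1.-primitive_root g, g != 0, i ^+ 2 = -1, i ^+ p = - i
    & forall j, chiF (field_norm (g ^+ j)) = (-1) ^+ j].
Proof.
have [g [gp gs]] := finField_generator F.
pose M := (2 * f + 1)%N.
have cM : #|F|.-1 = (8 * m * M)%N by rewrite cardF pE mE /M; lia.
have g0 : g != 0.
  apply/eqP => g0; have := prim_expr_order gp; rewrite g0 expr0n cM /=.
  have -> : (8 * m * M == 0)%N = false by have := half_prime_gt0; rewrite /M; lia.
  by move/eqP; rewrite eq_sym oner_eq0.
have n1 : g ^+ (4 * m * M) = -1.
  have : g ^+ (4 * m * M) != 1.
    have mM : (0 < m * M)%N by rewrite muln_gt0 half_prime_gt0 /M addn1.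
    rewrite -(prim_order_dvd gp) cM -!mulnA; move: (m * M)%N mM => n n0.
    by rewrite gtnNdvd //; lia.
  have : (g ^+ (4 * m * M)) ^+ 2 == 1.
    by rewrite -exprM -(prim_order_dvd gp) cM; apply/dvdnP; exists 1%N; lia.
  by rewrite sqrf_eq1 => /orP[/eqP ->|/eqP -> //]; rewrite eqxx.
have i2 : (g ^+ (2 * m * M)) ^+ 2 = -1 by rewrite -exprM -n1; congr (g ^+ _); lia.
move: i2; move: (g ^+ (2 * m * M)) => i i2; exists g, i; split=> //.
  rewrite (_ : p = (2 * (4 * f + 1)).+1)%N; last by rewrite pE mE; lia.
  by rewrite exprS exprM i2 exprD expr1 exprM -[(-1) ^+ 4]signr_odd expr1n mul1r mulrN1.
move=> j; rewrite /quad_char /field_norm -!exprM expf_eq0 (negbTE g0) andbF.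
have -> : g ^+ (j * p.+1 * m) = (-1) ^+ j.
  by rewrite -n1 -exprM; congr (g ^+ _); rewrite pE mE /M; lia.
rewrite -signr_odd -[in RHS]signr_odd; case: (odd j); rewrite ?eqxx // expr1.
by rewrite eq_sym oneN1 // two_neq0_ext.
Qed.

Lemma sum_chi_affine (x t : F) : x ^+ p = x -> t ^+ p = t -> t != 0 ->
  \sum_(c : 'F_p) chiF (x + iota c * t) = 0.
Proof.
move=> /frob_fixed[a ->] /frob_fixed[b ->]; rewrite fmorph_eq0 => b0.
under eq_bigr => c _ do rewrite -rmorphM -rmorphD chi_iota addrC mulrC.
rewrite (sum_scale (fun c => quad_char m (c + a))) // (sum_shift (fun c => quad_char m c)).
by rewrite (sum_chi cardFp_odd two_neq0_Fp).
Qed.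

(** Since x and y are independent over the prime field, some direction d / y of k
moves the trace of k x while fixing that of k y; averaging along that direction
gives zero. *)
Lemma sum_chi_trace_indep (d x y : F) : d ^+ p = - d -> d != 0 ->
  x != 0 -> y != 0 -> (x / y) ^+ p != x / y ->
  \sum_(k : F) chiF (field_trace (k * x)) * chiF (field_trace (k * y)) = 0.
Proof.
move=> dp d0 x0 y0 xy; set S := \sum_k _.
have T0 : field_trace (d / y * y) = 0 by rewrite mulfVK // /field_trace dp subrr.
have T1 : field_trace (d / y * x) != 0.
  have -> : field_trace (d / y * x) = - (d * ((x / y) ^+ p - x / y)).
    rewrite /field_trace (_ : d / y * x = d * (x / y)); last by field.
    by rewrite exprMn dp; ring.
  by rewrite oppr_eq0 mulf_neq0 // subr_eq0.
suff : (p%:Z * S) = 0.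
  by move/eqP; rewrite mulf_eq0 => /orP[/eqP|/eqP //]; have := prime_gt0 p_prime; lia.
transitivity (\sum_(c : 'F_p) S).
  by rewrite sumr_const card_Fp // -mulr_natl natz.
transitivity (\sum_(c : 'F_p) \sum_(k : F)
   chiF (field_trace (k * x) + iota c * field_trace (d / y * x)) * chiF (field_trace (k * y))).
  apply: eq_bigr => c _; rewrite /S -(sum_shift _ (iota c * (d / y))).
  apply: eq_bigr => k _; rewrite !mulrDl !field_traceD -!(mulrA (iota c)).
  by rewrite !(field_traceM _ (iota_frob c)) T0 mulr0 addr0.
rewrite exchange_big big1 //= => k _.
by rewrite -big_distrl /= sum_chi_affine ?mul0r // field_trace_fixed.
Qed.

(** The trace form k -> Tr (k x) vanishes exactly on a line. *)
Lemma sum_chi_trace_sq (d x : F) : d ^+ p = - d -> d != 0 -> x != 0 ->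
  \sum_(k : F) chiF (field_trace (k * x)) ^+ 2 = (p * (p - 1))%:Z.
Proof.
move=> dp d0 x0.
transitivity (\sum_(k : F) chiF (field_trace (d * k)) ^+ 2).
  rewrite -[RHS](sum_scale (fun k => chiF (field_trace (d * k)) ^+ 2) (_ : x / d != 0)).
    by apply: eq_bigr => k _; congr (chiF (field_trace _) ^+ 2); field.
  by rewrite mulf_neq0 ?invr_eq0.
transitivity (\sum_(k : F) (1 - (k \in codom iota)%:R : int)).
  apply: eq_bigr => k _.
  have E : field_trace (d * k) = d * (k - k ^+ p).
    by rewrite /field_trace exprMn dp; ring.
  case: (boolP (k \in codom iota)) => [/codomP[a ka]|kn].
    by rewrite E ka iota_frob subrr mulr0 chi0 subrr.
  rewrite subr0 chi_sq -?pE ?field_trace_fixed // E.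
  rewrite mulf_neq0 // subr_eq0; apply: contra kn => /eqP /esym /frob_fixed[a ->].
  exact: codom_f.
rewrite big_split /= sumr_const cardF sumrN.
under [X in _ - X]eq_bigr do rewrite mulrb.
rewrite -big_mkcond sumr_const card_codom; last exact: fmorph_inj.
rewrite card_Fp // !natz mulnBr muln1 -mulnn subzn //.
by rewrite leq_pmulr // prime_gt0.
Qed.

Let M := (2 * f + 1)%N.
(** Up to the factor 8 m, theta is psi: the summand of psi is invariant under
multiplication of z by g^M, a generator of the group of those z with z^4 in the
prime field. *)
Let theta (g : F) (k : F) : int := \sum_(j < M) (-1) ^+ j * chiF (field_trace (k * g ^+ (4 * j))).
Let psi (k : F) : int := \sum_(z : F) chiF (field_norm z) * chiF (field_trace (k * z ^+ 4)).

Lemma psi_scale (a k : F) : a != 0 -> psi (k * a ^+ 4) = chiF (field_norm a) * psi k.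
Proof.
move=> a0; rewrite /psi -[in RHS](sum_scale _ a0) big_distrr /=; apply: eq_bigr => z _.
have -> : field_norm (a * z) = field_norm a * field_norm z by rewrite /field_norm exprMn.
rewrite chi_fixedM ?field_norm_fixed // !mulrA -expr2.
rewrite chi_sq ?two_neq0_ext // -?pE ?field_norm_fixed //; last by rewrite expf_neq0.
by rewrite mul1r; congr (_ * chiF (field_trace _)); ring.
Qed.

Lemma psi_frob k : psi (k ^+ p) = psi k.
Proof.
have inj : injective (fun z : F => z ^+ p) by apply: (can_inj (g := fun z => z ^+ p)) => z; apply: frobK.
rewrite /psi [LHS](reindex_inj inj) /=; apply: eq_bigr => z _; congr (chiF _ * chiF _).
  by rewrite /field_norm -exprM mulnC exprM -/(field_norm z) field_norm_fixed.
by rewrite exprAC -exprMn /field_trace frobK addrC.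
Qed.

(** Writing z = s + t i, the norm is s^2 + t^2 and the trace of z^4 is
2 (s^4 - 6 s^2 t^2 + t^4); the line t = 0 supplies the point at infinity of the
octahedral sum. *)
Lemma psi_brewer (i : F) : i ^+ 2 = -1 -> i ^+ p = - i ->
  psi 1 = (4 * m)%:Z * brewer_sum 'F_p m.
Proof.
move=> i2 ip.
have i0 : i != 0 by apply/eqP => i0; move/eqP: i2; rewrite i0 expr0n eq_sym oppr_eq0 oner_eq0.
pose z (st : 'F_p * 'F_p) := iota st.1 + iota st.2 * i.
have zp s t : (iota s + iota t * i) ^+ p = iota s - iota t * i.
  by rewrite frobD exprMn !iota_frob ip mulrN.
have z_inj : injective z.
  move=> [s t] [s' t']; rewrite /z /= => e.
  have := congr1 (fun x => x ^+ p) e; rewrite !zp => e'.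
  have : 2 * iota s = 2 * iota s' by rewrite !mulr_natl !mulr2n; move: e e' => /eqP; rewrite -subr_eq0; move=> /eqP h1 /eqP; rewrite -subr_eq0 => /eqP h2; apply/eqP; rewrite -subr_eq0; apply/eqP; rewrite -[RHS](addr0 0) -{1}h1 -h2; ring.
  move/(mulfI two_neq0_ext)/fmorph_inj => es; move: e; rewrite es.
  by move/addrI/(mulIf i0)/fmorph_inj => ->.
have z_bij : bijective z.
  by apply: inj_card_bij => //; rewrite card_prod card_Fp // cardF mulnn.
rewrite /psi (reindex z) /=; last exact: onW_bij.
transitivity (\sum_(st : 'F_p * 'F_p)
   quad_char m ((st.1 ^+ 2 + st.2 ^+ 2) * (2 * (st.1 ^+ 4 - 6 * st.1 ^+ 2 * st.2 ^+ 2 + st.2 ^+ 4)))).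
  apply: eq_bigr => -[s t] _; rewrite /z /= quad_chiM ?cardFp_odd ?two_neq0_Fp // -!chi_iota.
  have i4 : i ^+ 4 = 1 by rewrite (exprM i 2 2) i2 sqrrN expr1n.
  congr (chiF _ * chiF _).
    rewrite /field_norm exprS zp rmorphD !rmorphXn.
    transitivity (iota s ^+ 2 - iota t ^+ 2 * i ^+ 2); first by ring.
    by rewrite i2; ring.
  rewrite mul1r /field_trace exprAC zp !(rmorphM, rmorphD, rmorphN, rmorph_nat, rmorphXn) /=.
  transitivity (2 * (iota s ^+ 4 + 6 * iota s ^+ 2 * iota t ^+ 2 * i ^+ 2 + iota t ^+ 4 * i ^+ 4)).
    by ring.
  by rewrite i2 i4; ring.
have cK := cardFp_odd; have K2 := two_neq0_Fp.
rewrite -(pair_bigA _ (fun s t : 'F_p =>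
   quad_char m ((s ^+ 2 + t ^+ 2) * (2 * (s ^+ 4 - 6 * s ^+ 2 * t ^+ 2 + t ^+ 4))))) /=.
rewrite exchange_big (bigD1 0) //=.
have -> : \sum_(s : 'F_p) quad_char m ((s ^+ 2 + 0 ^+ 2) * (2 * (s ^+ 4 - 6 * s ^+ 2 * 0 ^+ 2 + 0 ^+ 4))) =
   (m.*2)%:Z * quad_char m (2 : 'F_p).
  rewrite (bigD1 0) //= expr0n /= addr0 mul0r chi0 add0r.
  rewrite (eq_bigr (fun _ => quad_char m (2 : 'F_p))) => [|s s0].
    rewrite sumr_const (eq_card (B := predC1 (0 : 'F_p))) // cardC1 cK.
    by rewrite /= -[LHS]mulr_natl natz.
  apply: (@quad_chi_eq_sqr _ _ cK K2 _ _ (s ^+ 3)); first by rewrite expf_neq0.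
  by ring.
rewrite (eq_bigr (fun _ => quad_char m (2 : 'F_p) * (2 * (quad_char m (2 : 'F_p) * brewer_sum 'F_p m) - 1))) => [|t t0].
  rewrite sumr_const (eq_card (B := predC1 (0 : 'F_p))) // cardC1 cK /= -[_ *+ m.*2]mulr_natl natz.
  have := @chi_sq 'F_p m 2; rewrite exp_card_odd // => /(_ erefl K2).
  rewrite -muln2 !PoszM; move: (quad_char m _) (brewer_sum _ _) => a b aa.
  by transitivity (4 * m%:Z * a ^+ 2 * b); [ring | rewrite aa; ring].
rewrite -(sum_chi_octahedral cK K2) big_distrr /= -(sum_scale _ t0); apply: eq_bigr => s _.
rewrite -quad_chiM //; apply: (@quad_chi_eq_sqr _ _ cK K2 _ _ (t ^+ 3)); last by ring.
by rewrite expf_neq0.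
Qed.

(** The quartic twist classes behave as they do over a field with 1 modulo 8 elements,
with Frobenius on k playing the role of inversion. *)
Lemma brewer_sum_inert :
  exists c d : int, p%:Z = c ^+ 2 + 2 * d ^+ 2 /\ brewer_sum 'F_p m = 2 * c.
Proof.
have [g [i [gp g0 i2 ip chig]]] := generator_data.
have i0 : i != 0 by apply/eqP => i0; move/eqP: i2; rewrite i0 expr0n eq_sym oppr_eq0 oner_eq0.
have m0 := half_prime_gt0.
have cM : #|F|.-1 = (8 * m * M)%N by rewrite cardF pE mE /M; lia.
have psiE k : psi k = (8 * m)%:Z * theta g k.
  rewrite /psi (bigD1 0) //= /field_norm expr0n chi0 mul0r add0r (sum_powers _ gp) cM.
  rewrite (@sum_periodic (fun i => chiF (field_norm (g ^+ i)) * chiF (field_trace (k * (g ^+ i) ^+ 4)))) => [|j].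
    by congr (_ * _); apply: eq_bigr => j _; rewrite chig -exprM mulnC.
  have fix1 : (g ^+ (4 * M)) ^+ p = g ^+ (4 * M).
    rewrite -[in LHS](mulnC M) -exprM.
    have -> : (M * 4 * p = #|F|.-1 + 4 * M)%N by rewrite cardF pE mE /M; lia.
    by rewrite exprD prim_expr_order // mul1r.
  have -> : k * (g ^+ (j + M)) ^+ 4 = g ^+ (4 * M) * (k * (g ^+ j) ^+ 4).
    by rewrite -!exprM mulnDl exprD [(M * 4)%N]mulnC; ring.
  rewrite field_traceM // chi_fixedM ?field_trace_fixed //.
  have -> : chiF (g ^+ (4 * M)) = -1.
    by have := chig 1%N; rewrite /field_norm !expr1 => <-; congr (chiF (g ^+ _)); rewrite pE mE /M; lia.
  rewrite !chig exprD -[(-1) ^+ M]signr_odd.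
  have -> : odd M by rewrite /M; lia.
  by rewrite expr1; ring.
have m8 : (8 * m)%:Z != 0 by lia.
have th4 k : theta g (g ^+ (k + 4)) = - theta g (g ^+ k).
  apply: (mulfI m8); rewrite mulrN -!psiE exprD psi_scale //.
  by have := chig 1%N; rewrite !expr1 => ->; rewrite mulN1r.
have thM a j : theta g (g ^+ (a + 4 * j)) = (-1) ^+ j * theta g (g ^+ a).
  elim: j => [|j IH]; first by rewrite muln0 addn0 expr0 mul1r.
  by rewrite mulnS [(4 + _)%N]addnC addnA th4 IH exprS mulN1r mulNr.
have thp a : theta g (g ^+ (a * p)) = theta g (g ^+ a).
  by apply: (mulfI m8); rewrite -!psiE exprM psi_frob.
have th2 : theta g (g ^+ 2) = 0.
  have := thp 2%N; have -> : (2 * p = 2 + 4 * m)%N by lia.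
  rewrite thM -signr_odd; have -> : odd m by lia.
  by rewrite expr1; move: (theta _ _) => a; lia.
have th3 : theta g (g ^+ 3) = theta g (g ^+ 1).
  have := thp 1%N; have -> : (1 * p = 3 + 4 * (2 * f))%N by lia.
  by rewrite thM exprM sqrrN !expr1n mul1r.
have moment : \sum_k theta g k ^+ 2 = (M * (p * (p - 1)))%:Z.
  under eq_bigr => k _ do rewrite expr2 big_distrlr /=.
  rewrite exchange_big /=.
  transitivity (\sum_(a < M) \sum_(b < M) (if b == a then (p * (p - 1))%:Z else 0) : int).
    apply: eq_bigr => a _; rewrite exchange_big /=; apply: eq_bigr => b _.
    transitivity ((-1) ^+ a * (-1) ^+ b * \sum_k
       chiF (field_trace (k * g ^+ (4 * a))) * chiF (field_trace (k * g ^+ (4 * b)))).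
      by rewrite big_distrr; apply: eq_bigr => k _ /=; rewrite mulrACA.
    case: eqP => [->|ab].
      under eq_bigr do rewrite -expr2.
      by rewrite (sum_chi_trace_sq ip i0) ?expf_neq0 // -expr2 sqrr_sign mul1r.
    rewrite (sum_chi_trace_indep ip i0) ?expf_neq0 ?mulr0 //.
    rewrite exprMn exprVn -!exprM -(inj_eq (mulIf (expf_neq0 (4 * b * p) g0))).
    rewrite -(inj_eq (mulIf (expf_neq0 (4 * b) g0))) mulfVK ?expf_neq0 //.
    rewrite mulrAC mulfVK ?expf_neq0 // -!exprD (eq_prim_root_expr gp) cM.
    apply/negP => h; apply: ab; apply/val_inj => /=.
    have sub_dvd (u v : nat) : (u <= v)%N -> (4 * u * p + 4 * v == 4 * v * p + 4 * u %[mod 8 * m * M])%N ->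
        (v < M)%N -> u = v.
      move/subnKC <-; move: (v - u)%N => d.
      have -> : (4 * (u + d) * p + 4 * u = (4 * u * p + 4 * (u + d)) + 8 * m * d)%N.
        by rewrite pE -muln2; ring.
      rewrite eq_sym eqn_mod_dvd ?leq_addr // addKn dvdn_pmul2l; last by lia.
      case: d => [|d]; first by rewrite addn0.
      by move/dvdn_leq => /(_ isT); lia.
    rewrite [(4 * a + _)%N]addnC in h; case: (leqP a b) => [l|/ltnW l]; last by apply: sub_dvd; rewrite // eq_sym.
    by apply/esym/sub_dvd.
  under eq_bigr => a _ do rewrite -big_mkcond big_pred1_eq.
  by rewrite sumr_const card_ord -mulr_natl natz -PoszM.
have th0 : theta g 0 = 0.
  by rewrite /theta big1 // => j _; rewrite mul0r /field_trace expr0n; case: (p) (prime_gt0 p_prime) => // n _; rewrite /= addr0 chi0 mulr0.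
have e8 : (8 * m * M = 2 * m * M * 4)%N by lia.
move: moment; rewrite (bigD1 0) //= th0 expr0n add0r (sum_powers _ gp) cM e8.
rewrite (@sum_antiperiodic4_sq (fun i => theta g (g ^+ i))) // => e.
exists (theta g 1), (theta g (g ^+ 1)); split.
  have h : (2 * m * M)%:Z != 0 by rewrite /M; lia.
  apply: (mulfI h); rewrite -[theta g 1]/(theta g (g ^+ 0)) e.
  by rewrite pE subn1 /= -PoszM; congr Posz; lia.
have := psiE 1; rewrite (psi_brewer i2 ip).
have -> : (8 * m)%:Z = (4 * m)%:Z * 2 by lia.
by rewrite -mulrA; apply: mulfI; lia.
Qed.

End Inert.
End QuadraticExtension.

Lemma quadratic_extension (p : nat) : prime p ->
  exists (F : finFieldType) (iota : {rmorphism 'F_p -> F}), #|F| = (p ^ 2)%N.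
Proof.
move=> p_prime; have [F0 charF cF] := pPrimePowerField p_prime (isT : 0 < 2)%N.
by exists (pPrimeCharType charF : finFieldType), (in_alg (pPrimeCharType charF)).
Qed.

(** * The Brewer sum at a prime *)

Section BrewerPrime.
Variables (p m : nat).
Hypotheses (p_prime : prime p) (pE : p = m.*2.+1).

Lemma quad_char_m2 : quad_char m (-2 : 'F_p) = if (p %% 8 < 4)%N then 1 else -1.
Proof. by have [F [iota cF]] := quadratic_extension p_prime; apply: (chi_m2 p_prime pE iota cF). Qed.

Lemma brewer_sum_inert_eq0 : p = 5 %[mod 8] \/ p = 7 %[mod 8] -> brewer_sum 'F_p m = 0.
Proof.
move=> h; apply: (@brewer_sum_eq0 'F_p m (cardFp_odd p_prime pE) (two_neq0_Fp p_prime pE)).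
by rewrite quad_char_m2; case: h => ->.
Qed.

Lemma brewer_sum_repr : p = 1 %[mod 8] \/ p = 3 %[mod 8] ->
  exists c d : int, p%:Z = c ^+ 2 + 2 * d ^+ 2 /\ brewer_sum 'F_p m = 2 * c.
Proof.
case=> h.
  have mE : m = (4 * (p %/ 8))%N by lia.
  have [c [d [e b]]] := @brewer_sum_split 'F_p m (cardFp_odd p_prime pE) (two_neq0_Fp p_prime pE) _ mE.
  by exists c, d; split=> //; rewrite -e card_Fp.
have mE : m = (4 * (p %/ 8) + 1)%N by lia.
have [F [iota cF]] := quadratic_extension p_prime.
exact: (brewer_sum_inert p_prime pE iota cF mE).
Qed.

End BrewerPrime.

(** The prime p divides (a d - c b) (a d + c b), and
p^2 = (a c + 2 b d)^2 + 2 (a d - c b)^2 leaves no room for a nonzero multiple of p. *)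
Lemma repr_x2_2y2_uniq (p : nat) (a b c d : int) : prime p ->
  p%:Z = a ^+ 2 + 2 * b ^+ 2 -> p%:Z = c ^+ 2 + 2 * d ^+ 2 -> a ^+ 2 = c ^+ 2.
Proof.
move=> p_prime e1 e2; have p0 := prime_gt0 p_prime.
wlog dvd : a e1 / (p%:Z %| a * d - c * b)%Z.
  move=> H; have : (p%:Z %| (a * d - c * b) * (a * d + c * b))%Z.
    apply/dvdzP; exists (d ^+ 2 - b ^+ 2).
    have -> : (a * d - c * b) * (a * d + c * b) = a ^+ 2 * d ^+ 2 - c ^+ 2 * b ^+ 2 by ring.
    have -> : a ^+ 2 = p%:Z - 2 * b ^+ 2 by rewrite e1; ring.
    have -> : c ^+ 2 = p%:Z - 2 * d ^+ 2 by rewrite e2; ring.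
    by ring.
  rewrite dvdzE abszM Euclid_dvdM // => /orP[h|h]; first exact: H.
  rewrite -(sqrrN a); apply: H; first by rewrite sqrrN.
  by rewrite dvdzE mulNr -opprD abszN.
have z : a * d - c * b = 0.
  have [q qE] := dvdzP dvd.
  have e3 : p%:Z ^+ 2 = (a * c + 2 * b * d) ^+ 2 + 2 * (a * d - c * b) ^+ 2.
    by rewrite expr2 {1}e1 e2; ring.
  rewrite qE in e3 *; suff /eqP -> : q == 0 by rewrite mul0r.
  have : 0 <= p%:Z ^+ 2 * (1 - 2 * q ^+ 2).
    have -> : p%:Z ^+ 2 * (1 - 2 * q ^+ 2) = (a * c + 2 * b * d) ^+ 2.
      have -> : p%:Z ^+ 2 * (1 - 2 * q ^+ 2) = p%:Z ^+ 2 - 2 * (q * p%:Z) ^+ 2 by ring.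
      by rewrite e3; ring.
    exact: sqr_ge0.
  rewrite pmulr_rge0; last by rewrite exprn_gt0 // ltz_nat.
  apply: contraTT => q0; have : 0 < q ^+ 2 by rewrite exprn_even_gt0.
  by move: (q ^+ 2) => r r0; rewrite -ltNge; clear -r0; lia.
have ad : a * d = c * b by apply/eqP; rewrite -subr_eq0 z.
have : a ^+ 2 * p%:Z = c ^+ 2 * p%:Z.
  rewrite {1}e2 e1.
  transitivity (a ^+ 2 * c ^+ 2 + 2 * (a * d) ^+ 2); first by ring.
  by rewrite ad; ring.
by apply: mulIf; clear -p0; lia.
Qed.

(** * Clausen's formula *)

Definition ucoef (k : nat) : nat := 'C(6 * k, 3 * k) * 'C(3 * k, k).
Definition acoef (k : nat) : nat := 'C(2 * k, k) * ucoef k.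

Lemma ucoef_fact k : (ucoef k * (k`! * (2 * k)`! * (3 * k)`!))%N = (6 * k)`!.
Proof.
have h1 := @bin_fact (6 * k) (3 * k) (ltac:(lia)).
have h2 := @bin_fact (3 * k) k (ltac:(lia)).
rewrite -h1 (_ : 6 * k - 3 * k = 3 * k)%N; last by lia.
rewrite -{2}h2 (_ : 3 * k - k = 2 * k)%N; last by lia.
by rewrite /ucoef; ring.
Qed.

Lemma ucoef_rec k : (ucoef k.+1 * k.+1 ^ 2 = 12 * (6 * k + 1) * (6 * k + 5) * ucoef k)%N.
Proof.
have := ucoef_fact k.+1; have := ucoef_fact k.
have -> : (6 * k.+1 = (6 * k).+1.+1.+1.+1.+1.+1)%N by lia.
have -> : (2 * k.+1 = (2 * k).+1.+1)%N by lia.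
have -> : (3 * k.+1 = (3 * k).+1.+1.+1)%N by lia.
rewrite !factS => <- e.
have c0 : (0 < (3 * k).+1 * (3 * k).+2 * (3 * k).+3 * (2 * k).+1 * 2 * (k`! * (2 * k)`! * (3 * k)`!))%N.
  by rewrite !muln_gt0 !fact_gt0.
apply/eqP; rewrite -(eqn_pmul2r c0); apply/eqP.
transitivity (ucoef k.+1 * (k.+1 * k`! * ((2 * k).+2 * ((2 * k).+1 * (2 * k)`!)) *
  ((3 * k).+3 * ((3 * k).+2 * ((3 * k).+1 * (3 * k)`!)))))%N.
  by ring.
by rewrite e; ring.
Qed.

Lemma central_bin_rec k :
  ('C(2 * k.+1, k.+1) * k.+1 = 2 * (2 * k + 1) * 'C(2 * k, k))%N.
Proof.
have h1 := @bin_fact (2 * k) k (ltac:(lia)).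
have h2 := @bin_fact (2 * k.+1) k.+1 (ltac:(lia)).
move: h1 h2; rewrite (_ : 2 * k - k = k)%N; last by lia.
rewrite (_ : 2 * k.+1 - k.+1 = k.+1)%N; last by lia.
have -> : (2 * k.+1 = (2 * k).+1.+1)%N by lia.
rewrite !factS => <- e.
have c0 : (0 < k.+1 * (k`! * k`!))%N by rewrite !muln_gt0 !fact_gt0.
apply/eqP; rewrite -(eqn_pmul2r c0); apply/eqP.
transitivity ('C((2 * k).+2, k.+1) * (k.+1 * k`! * (k.+1 * k`!)))%N; first by ring.
by rewrite e; ring.
Qed.

Lemma acoef_rec k :
  (acoef k.+1 * k.+1 ^ 3 = 24 * (2 * k + 1) * (6 * k + 1) * (6 * k + 5) * acoef k)%N.
Proof.
have := central_bin_rec k; rewrite /acoef; have := ucoef_rec k.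
move: ('C(2 * k.+1, k.+1)) ('C(2 * k, k)) (ucoef k.+1) (ucoef k) => b b' u u' cu cb.
transitivity ((b * k.+1) * (u * k.+1 ^ 2))%N; first by ring.
by rewrite cb cu; ring.
Qed.

Section Vanish.
Variable R : comNzRingType.
Implicit Types p r : {poly R}.

Definition vanish (n : nat) p := forall k, (k < n)%N -> p`_k = 0.

Lemma vanishD n p r : vanish n p -> vanish n r -> vanish n (p + r).
Proof. by move=> hp hr k kn; rewrite coefD hp // hr // addr0. Qed.

Lemma vanishN n p : vanish n p -> vanish n (- p).
Proof. by move=> hp k kn; rewrite coefN hp // oppr0. Qed.

Lemma vanishMn n p c : vanish n p -> vanish n (p *+ c).
Proof. by move=> hp k kn; rewrite coefMn hp // mul0rn. Qed.

Lemma vanishM i j p r : vanish i p -> vanish j r -> vanish (i + j) (p * r).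
Proof.
move=> hp hr k kn; rewrite coefM big1 // => a _.
have [ai|ia] := ltnP a i; first by rewrite hp // mul0r.
by rewrite hr ?mulr0 //; have := ltn_ord a; lia.
Qed.

Lemma vanish0 p : vanish 0 p. Proof. by []. Qed.

Lemma vanishMl n p r : vanish n r -> vanish n (p * r).
Proof. exact: (vanishM (@vanish0 p)). Qed.

Lemma vanish_deriv n p : vanish n.+1 p -> vanish n p^`().
Proof. by move=> hp k kn; rewrite coef_deriv hp // mul0rn. Qed.

Lemma vanishX n p : vanish 1 p -> vanish n (p ^+ n).
Proof.
move=> hp; elim: n => [|n IH] //; rewrite exprS -[n.+1]add1n; exact: vanishM.
Qed.

Lemma vanish_comp n p r : vanish n p -> vanish 1 r -> vanish n (p \Po r).
Proof.
move=> hp hr k kn; rewrite coef_comp_poly big1 // => i _.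
have [ik|ki] := ltnP i n; first by rewrite hp // mul0r.
by rewrite (vanishX hr (leq_trans kn ki)) mulr0.
Qed.

End Vanish.

Section Clausen.

Definition clausen_q (R : comNzRingType) : {poly R} := 'X - 'X ^+ 2 *+ 432.

Lemma vanish_clausen_q (R : comNzRingType) : vanish 1 (clausen_q R).
Proof. by move=> [|k] // _; rewrite coefB coefMn coefX coefXn mul0rn subr0. Qed.

Local Notation q := (clausen_q int).
Implicit Types P W : {poly int}.

Lemma coef_qM P n : (q * P)`_n.+1 = P`_n - (if n is k.+1 then P`_k else 0) *+ 432.
Proof.
rewrite /clausen_q mulrBl mulrnAl coefB coefMn coefXM coefXnM /=.
by case: n => [|n] //=; rewrite !subSS subn0.
Qed.

Lemma lead_qM n P : vanish n P -> (q * P)`_n.+1 = P`_n.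
Proof.
by move=> hP; rewrite coef_qM; case: n hP => [|n] hP; rewrite ?(hP n (leqnn _)) mul0rn subr0.
Qed.

Lemma vanish_qM n P : vanish n P -> vanish n.+1 (q * P).
Proof. exact: (vanishM (@vanish_clausen_q int)). Qed.

(** If U solves (g U')' = 60 U then U^2 is annihilated by this operator, the symmetric
square of that equation. *)
Definition diff_op (g W : {poly int}) :=
  (g * ((g * W^`())^`() - W *+ 120))^`() - (g * W^`()) *+ 120.
Local Notation clausen_op := (diff_op q).

Lemma diff_opB g W P : diff_op g (W - P) = diff_op g W - diff_op g P.
Proof. by rewrite /diff_op !(derivMn, derivN, derivM, derivD); ring. Qed.

(** The defect E of the equation for U controls the defect of the equation for U^2. *)
Lemma diff_op_sqr g W (E := (g * W^`())^`() - W *+ 60) :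
  diff_op g (W ^+ 2) = W * g^`() * E *+ 2 + (g * W^`()) * E *+ 6 + W * (g * E^`()) *+ 2.
Proof. by rewrite /diff_op /E expr2 !(derivMn, derivN, derivM, derivD); ring. Qed.

Lemma lead_clausen_op k W : vanish k.+1 W -> (clausen_op W)`_k = W`_k.+1 *+ (k.+1 ^ 3).
Proof.
move=> hW; have hD := vanish_deriv hW; have hqD := vanish_qM hD.
have hDqD := vanish_deriv hqD.
have h2 : vanish k ((q * W^`())^`() - W *+ 120).
  apply: vanishD => //; apply/vanishN/vanishMn => i ik; apply: hW; exact: ltnW.
rewrite /diff_op coefB coefMn hqD // mul0rn subr0 coef_deriv lead_qM // coefB coefMn hW //.
by rewrite mul0rn subr0 coef_deriv lead_qM // coef_deriv -!mulrnA.
Qed.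

(** The leading coefficient k^3 of the operator at degree k never vanishes for k > 0, so
a solution is determined by its constant term. *)
Lemma clausen_op_inj n W : W`_0 = 0 -> vanish n (clausen_op W) -> vanish n.+1 W.
Proof.
move=> W0 hW; elim: n hW => [|n IH] hW; first by case.
have {}IH : vanish n.+1 W by apply: IH => k kn; apply: hW; apply: leqW.
move=> k; rewrite ltnS leq_eqVlt => /orP[/eqP ->|/IH //].
have := hW n (ltnSn n); rewrite lead_clausen_op // => /eqP.
by rewrite mulrn_eq0 expn_eq0 /= => /eqP.
Qed.

Definition upoly (R : nzRingType) N : {poly R} := \poly_(k < N) (ucoef k)%:R.
Definition apoly (R : nzRingType) N : {poly R} := \poly_(k < N) (acoef k)%:R.

Lemma upoly_ode n :
  vanish n ((q * (upoly int n.+1)^`())^`() - upoly int n.+1 *+ 60).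
Proof.
move=> k kn; rewrite coefB coefMn coef_deriv coef_qM.
have U i : (i < n.+1)%N -> (upoly int n.+1)`_i = (ucoef i)%:R by move=> h; rewrite coef_poly h.
rewrite coef_deriv U //; have := ucoef_rec k.
case: k kn => [|k] kn; rewrite ?coef_deriv !U //; try lia.
all: by rewrite !natz; lia.
Qed.

Lemma clausen_op_square n : vanish n (clausen_op (upoly int n.+1 ^+ 2)).
Proof.
have := @upoly_ode n; set U := upoly _ _; set E := (_ - _) => hE.
rewrite diff_op_sqr -/E; apply: vanishD; first by apply: vanishD; apply: vanishMn; apply: vanishMl.
apply: vanishMn; apply: vanishMl; case: (n) hE => [|k] // hE.
by apply: vanish_qM; apply: vanish_deriv.
Qed.

(** With x the variable and s0, ..., s3 the successive derivatives of S, this is the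
third-order hypergeometric operator whose recursion is that of the a_k. *)
Definition hyper_op (x s0 s1 s2 s3 : {poly int}) :=
  (1 - x *+ 1728) * (s1 + x * s2 *+ 3 + x * (x * s3)) - (x * s1 + x * (x * s2)) *+ 1728
    - x * s1 *+ 1968 - x * (x * s2) *+ 864 - s0 *+ 120.

Lemma hyper_op_morph (f : {rmorphism {poly int} -> {poly int}}) x s0 s1 s2 s3 :
  f (hyper_op x s0 s1 s2 s3) = hyper_op (f x) (f s0) (f s1) (f s2) (f s3).
Proof. by rewrite /hyper_op !(rmorphMn, rmorphB, rmorphD, rmorphM, rmorph1). Qed.

(** The hypotheses on g hold for x (1 - 432 x): they say that the two equations are
related by the change of variable g. *)
Lemma diff_op_comp (g P : {poly int}) :
    g^`() ^+ 2 = 1 - g *+ 1728 -> g^`()^`() = - (1 *+ 864) ->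
  diff_op g (P \Po g) = g^`() * (hyper_op 'X P P^`() P^`()^`() P^`()^`()^`() \Po g).
Proof.
move=> g1 g2.
rewrite (hyper_op_morph (comp_poly g)) /= comp_polyX.
have e0 := deriv_comp P g; have e1 := deriv_comp P^`() g; have e2 := deriv_comp P^`()^`() g.
move: (P \Po g) (P^`() \Po g) (P^`()^`() \Po g) (P^`()^`()^`() \Po g) e0 e1 e2.
move=> s0 s1 s2 s3 e0 e1 e2; rewrite /diff_op.
have e3 : (g * s0^`())^`() = (1 - g *+ 1728) * (s1 + g * s2) - g * s1 *+ 864.
  rewrite e0 !derivM e1 g2.
  transitivity (g^`() ^+ 2 * (s1 + g * s2) - g * s1 *+ 864); first by ring.
  by rewrite g1.
rewrite e3 e0 /hyper_op; have d1 : (1 : {poly int})^`() = 0 by exact: derivC.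
by rewrite !(derivMn, derivN, derivM, derivD) e0 e1 e2 d1; ring.
Qed.

Lemma clausen_op_comp n : vanish n (clausen_op (apoly int n.+1 \Po q)).
Proof.
have q1 : q^`() = 1 - 'X *+ 864.
  by rewrite /clausen_q derivB derivMn derivXn derivX; ring.
have q2 : q^`()^`() = - (1 *+ 864) by rewrite q1 derivB derivMn derivX derivC; ring.
rewrite diff_op_comp //; last by rewrite q1 /clausen_q; ring.
apply: vanishMl; apply: vanish_comp; last exact: vanish_clausen_q.
move=> k kn; rewrite /hyper_op mulrBl mul1r mulrnAl.
rewrite !(coefMn, coefXM, coef_deriv, coefN, coefD) /=.
have Sc i : (i < n.+1)%N -> (apoly int n.+1)`_i = (acoef i)%:R by move=> h; rewrite coef_poly h.
have := acoef_rec k.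
by case: k kn => [|[|[|k]]] kn /=; rewrite !Sc; lia.
Qed.

(** Clausen's formula, as a congruence between truncations: both sides have constant
term 1 and are killed by the same operator up to terms of high degree. *)
Lemma clausen n : vanish n.+1 (upoly int n.+1 ^+ 2 - (apoly int n.+1 \Po q)).
Proof.
apply: clausen_op_inj.
  rewrite -horner_coef0 hornerD hornerN horner_exp horner_comp.
  have -> : q.[0] = 0 by rewrite horner_coef0 vanish_clausen_q.
  by rewrite !horner_coef0 !coef_poly.
rewrite diff_opB; apply: vanishD; first exact: clausen_op_square.
exact/vanishN/clausen_op_comp.
Qed.

End Clausen.

(** * Divisibility of the coefficients *)

Lemma logn_fact_small p n : prime p -> (n < p ^ 2)%N -> logn p n`! = (n %/ p)%N.
Proof.
move=> p_prime np; rewrite logn_fact //.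
case: n np => [|n] np; first by rewrite big_geq // div0n.
rewrite big_ltn // expn1 big_nat_cond big1 ?addn0 // => k /andP[/andP[k2 _] _].
by apply: divn_small; apply: (leq_trans np); rewrite leq_exp2l // prime_gt1.
Qed.

Lemma logn_ucoef p k : prime p -> (6 < p)%N -> (k < p)%N ->
  (logn p (ucoef k) + (2 * k) %/ p + (3 * k) %/ p = (6 * k) %/ p)%N.
Proof.
move=> p_prime p6 kp; have p2 : (6 * k < p ^ 2)%N by rewrite -mulnn; nia.
have L n : (n <= 6 * k)%N -> logn p n`! = (n %/ p)%N.
  by move=> nk; apply: logn_fact_small => //; apply: leq_ltn_trans nk p2.
have u0 : (0 < ucoef k)%N by rewrite muln_gt0 !bin_gt0; lia.
have := ucoef_fact k; move: (ucoef k) u0 => u u0 /(congr1 (logn p)).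
rewrite !lognM ?(muln_gt0, u0, fact_gt0) // !L; try lia.
by rewrite (divn_small kp) add0n addnA.
Qed.

(** Only the first power of p can occur in the factorials, so the valuation of u_k is
floor(6k/p) - floor(3k/p) - floor(2k/p). *)
Lemma dvdn_ucoef p k : prime p -> (6 < p)%N -> (k < p)%N -> (p <= 6 * k)%N ->
  (p ^ ((5 * p <= 6 * k).+1) %| ucoef k)%N.
Proof.
move=> p_prime p6 kp pk.
have u0 : (0 < ucoef k)%N by rewrite muln_gt0 !bin_gt0; lia.
rewrite pfactor_dvdn //; have := logn_ucoef p_prime p6 kp.
have p0 : (0 < p)%N by lia.
have hx := ltn_ceil (3 * k) p0; have hx' := leq_trunc_div (3 * k) p.
have hy := ltn_ceil (2 * k) p0; have hy' := leq_trunc_div (2 * k) p.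
have hz := ltn_ceil (6 * k) p0.
have x3 : ((3 * k) %/ p < 3)%N by rewrite ltn_divLR //; lia.
have y2 : ((2 * k) %/ p < 2)%N by rewrite ltn_divLR //; lia.
have z6 : ((6 * k) %/ p < 6)%N by rewrite ltn_divLR //; lia.
move: ((6 * k) %/ p)%N ((2 * k) %/ p)%N ((3 * k) %/ p)%N hx hx' hy hy' hz x3 y2 z6 => z y x.
move=> hx hx' hy hy' hz x3 y2 z6.
case: x x3 hx hx' => [|[|[|x]]] // _ hx hx'; case: y y2 hy hy' => [|[|y]] // _ hy hy'.
all: case: z z6 hz => [|[|[|[|[|[|z]]]]]] // _ hz; case: (leqP (5 * p) (6 * k)); lia.
Qed.

Lemma dvdn_acoef p k : prime p -> (6 < p)%N -> (k < p)%N -> (p <= 2 * k)%N ->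
  (p ^ 2 %| acoef k)%N.
Proof.
move=> p_prime p6 kp pk; rewrite /acoef -mulnn; apply: dvdn_mul; last first.
  have := dvdn_ucoef p_prime p6 kp (ltac:(lia)); apply: dvdn_trans.
  by rewrite expnS dvdn_mulr.
have b0 : (0 < 'C(2 * k, k))%N by rewrite bin_gt0; lia.
have L n : (n <= 2 * k)%N -> logn p n`! = (n %/ p)%N.
  by move=> nk; apply: logn_fact_small => //; rewrite -mulnn; nia.
rewrite -[p]expn1 pfactor_dvdn //; have := congr1 (logn p) (@bin_fact (2 * k) k (ltac:(lia))).
rewrite (_ : 2 * k - k = k)%N; last by lia.
rewrite !lognM ?(muln_gt0, b0, fact_gt0) // !L; try lia.
by rewrite (divn_small kp) !addn0 => ->; rewrite divn_gt0 //; lia.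
Qed.

(** For i >= p, in a product u_j u_(i-j) either one index is at least 5p/6 or both are
at least p/6; and only the a_k with 2k >= p can contribute to the coefficient i
of the composite. *)
Lemma coef_clausen_high p i : prime p -> (6 < p)%N -> (p <= i)%N ->
  ((p ^ 2)%:Z %| (upoly int p ^+ 2 - (apoly int p \Po clausen_q int))`_i)%Z.
Proof.
move=> p_prime p6 pi; have p0 : (0 < p)%N by lia.
rewrite coefB; apply: rpredB.
  rewrite expr2 coefM; apply: rpred_sum => j _; rewrite !coef_poly.
  case: ltnP => jp; last by rewrite mul0r rpred0.
  case: ltnP => ijp; last by rewrite mulr0 rpred0.
  rewrite !natz -PoszM dvdzE !absz_nat.
  have ji : (j <= i)%N by rewrite -ltnS.
  have dv k : (k < p)%N -> (5 * p <= 6 * k)%N -> (p ^ 2 %| ucoef k)%N.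
    by move=> kp h; have := dvdn_ucoef p_prime p6 kp (ltac:(lia)); rewrite h.
  have dv1 k : (k < p)%N -> (p <= 6 * k)%N -> (p %| ucoef k)%N.
    move=> kp h; apply: dvdn_trans (dvdn_ucoef p_prime p6 kp h).
    by rewrite expnS dvdn_mulr.
  case: (leqP (5 * p) (6 * j)) => hj; first by apply/dvdn_mulr/dv.
  case: (leqP (5 * p) (6 * (i - j))) => hij; first by apply/dvdn_mull/dv.
  by rewrite -mulnn; apply: dvdn_mul; apply: dv1 => //; lia.
rewrite coef_comp_poly; apply: rpred_sum => k _; rewrite coef_poly.
case: ltnP => kp; last by rewrite mul0r rpred0.
case: (leqP i (2 * k)) => ik.
  by apply: dvdz_mulr; rewrite natz dvdzE !absz_nat dvdn_acoef //; lia.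
rewrite [X in _ * X]nth_default ?mulr0 ?rpred0 //.
apply: leq_trans (size_poly_exp_leq _ _) _; apply: leq_ltn_trans ik.
rewrite leq_mul2r; apply/orP; right.
have : (size (clausen_q int) <= 3)%N.
  apply/leq_sizeP => -[|[|[|j]]] // _.
  by rewrite coefB coefX coefMn coefXn mul0rn subr0.
by case: (size _).
Qed.

Lemma clausen_trunc p (R : comNzRingType) : prime p -> (6 < p)%N -> (p ^ 2)%:R = 0 :> R ->
  apoly R p \Po clausen_q R = upoly R p ^+ 2.
Proof.
move=> p_prime p6 p20.
pose f : {rmorphism int -> R} := intr.
have mU : upoly R p = map_poly f (upoly int p).
  by apply/polyP => i; rewrite coef_map !coef_poly; case: ifP => _; [exact: esym (rmorph_nat f _) | exact: esym (rmorph0 f)].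
have mA : apoly R p = map_poly f (apoly int p).
  by apply/polyP => i; rewrite coef_map !coef_poly; case: ifP => _; [exact: esym (rmorph_nat f _) | exact: esym (rmorph0 f)].
have mq : clausen_q R = map_poly f (clausen_q int).
  by rewrite /clausen_q rmorphB rmorphMn rmorphXn /= map_polyX.
rewrite mU mA mq -map_comp_poly -rmorphXn; apply/esym/eqP; rewrite -subr_eq0 -rmorphB.
apply/eqP/polyP => i; rewrite coef_map coef0.
case: (ltnP i p) => ip.
  have := @clausen p.-1; rewrite prednK ?prime_gt0 // => /(_ i ip) ->.
  exact: rmorph0.
have /dvdzP[c ->] := coef_clausen_high p_prime p6 ip.
have fp : f (p ^ 2)%:Z = 0 by exact: p20.
by apply: (etrans (rmorphM f _ _)); rewrite fp mulr0.
Qed.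

(** * The value at 1/8000 *)

Section EvenOdd.
Variable R : comNzRingType.
Implicit Types P Q : {poly R}.

Lemma even_poly_compX2 P : even_poly (P \Po 'X^2) = P.
Proof.
apply/polyP => i; rewrite coef_even_poly coef_comp_poly_Xn // -muln2 dvdn_mull //.
by rewrite mulnK.
Qed.

Lemma odd_poly_compX2 P : odd_poly (P \Po 'X^2) = 0.
Proof.
apply/polyP => i; rewrite coef_odd_poly coef_comp_poly_Xn // coef0.
by rewrite dvdn2 /= odd_double.
Qed.

Lemma even_poly_sqr P : even_poly (P ^+ 2) = even_poly P ^+ 2 + 'X * odd_poly P ^+ 2.
Proof.
set A := even_poly P; set B := odd_poly P.
have -> : P ^+ 2 = ((A ^+ 2 + 'X * B ^+ 2) \Po 'X^2) + ((A * B *+ 2) \Po 'X^2) * 'X.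
  rewrite -{1}(poly_even_odd P) -/A -/B comp_polyD rmorphMn /= !comp_polyM comp_polyX.
  by ring.
by rewrite even_polyD even_polyMX even_poly_compX2 odd_poly_compX2 mul0r addr0.
Qed.

(** The parameter s stands for 1/864. *)
Definition upoly_t (s : R) p := upoly R p \Po (s%:P * (1 - 'X)).

(** The composite of x (1 - 432 x) with x = s (1 - t) is the even function
(1 - t^2) / 1728 = 432 s^2 (1 - t^2).  Taking even parts in Clausen's formula
replaces t^2 by a value that need not be a square. *)
Lemma apoly_value p (s t : R) : prime p -> (6 < p)%N -> (p ^ 2)%:R = 0 :> R -> 864 * s = 1 ->
  (apoly R p).[432 * s ^+ 2 * (1 - t)] =
  (even_poly (upoly_t s p)).[t] ^+ 2 + t * (odd_poly (upoly_t s p)).[t] ^+ 2.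
Proof.
move=> p_prime p6 p20 s864.
have := clausen_trunc p_prime p6 p20.
move/(congr1 (fun P => even_poly (P \Po (s%:P * (1 - 'X))))).
rewrite rmorphXn /= even_poly_sqr -/(upoly_t s p) -comp_polyA.
have -> : clausen_q R \Po (s%:P * (1 - 'X)) = ((432 * s ^+ 2)%:P * (1 - 'X)) \Po 'X^2.
  have es : s%:P = 864 * (s ^+ 2)%:P :> {poly R}.
    by rewrite -[in LHS](mul1r s) -s864 -mulrA -expr2 polyCM rmorph_nat.
  have e2 : s%:P * s%:P = (s ^+ 2)%:P by rewrite -polyCM.
  have e432 : (432 * s ^+ 2)%:P = 432 * (s ^+ 2)%:P :> {poly R} by rewrite polyCM rmorph_nat.
  rewrite /clausen_q comp_polyB rmorphMn /= comp_Xn_poly comp_polyX comp_polyM comp_polyB.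
  rewrite comp_polyX -[1]/(1%:P) !comp_polyC -[1%:P]/(1 : {poly R}) e432.
  transitivity (s%:P * (1 - 'X) - s%:P * s%:P * (1 - 'X) ^+ 2 *+ 432); first by ring.
  by rewrite e2 es; ring.
rewrite comp_polyA even_poly_compX2 => /(congr1 (fun P => P.[t])).
by rewrite horner_comp !hornerE.
Qed.

End EvenOdd.

(** * The truncated series modulo p as a Hasse invariant *)

Section ModP.
Variables (p m : nat).
Hypotheses (p_prime : prime p) (pE : p = m.*2.+1).
Local Notation K := 'F_p.

Lemma natr_Fp_eq0 n : (n%:R == 0 :> K) = (p %| n)%N.
Proof. by rewrite -(dvdn_pcharf (pchar_Fp p_prime)). Qed.

Lemma natr_Fp_neq0 n : (0 < n)%N -> (n < p)%N -> n%:R != 0 :> K.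
Proof. by move=> n0 np; rewrite natr_Fp_eq0 gtnNdvd. Qed.

Lemma Fp_half : 2 * m%:R = -1 :> K.
Proof.
have : (2 * m + 1)%:R = 0 :> K.
  by apply/eqP; rewrite natr_Fp_eq0; apply/dvdnP; exists 1%N; lia.
by rewrite natrD natrM => /eqP; rewrite addr_eq0 => /eqP.
Qed.

Lemma Fp_exp_card (x : K) : x ^+ p = x.
Proof. by have := expf_card x; rewrite card_Fp. Qed.

Lemma Fp_exp_pred (x : K) : x != 0 -> x ^+ m.*2 = 1.
Proof. by move=> x0; apply: (mulfI x0); rewrite -exprS -pE Fp_exp_card mulr1. Qed.

Lemma sum_powers_Fp n :
  \sum_(x : K) x ^+ n = if (0 < n)%N && (m.*2 %| n)%N then -1 else 0.
Proof.
case: n => [|n] /=.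
  under eq_bigr do rewrite expr0.
  by rewrite sumr_const card_Fp //; apply/eqP; rewrite natr_Fp_eq0.
case: ifP => dn.
  rewrite (bigD1 0) //= expr0n add0r (eq_bigr (fun _ => 1)) => [|x x0].
    rewrite sumr_const (eq_card (B := predC1 (0 : K))) // cardC1 card_Fp //.
    have := Fp_half; rewrite -natrM mul2n => <-; by rewrite pE.
  by case/dvdnP: dn => c ->; rewrite mulnC exprM Fp_exp_pred // expr1n.
have [g [gp gs]] := finField_generator K.
have g0 : g != 0.
  apply/eqP => g0; have := prim_expr_order gp; rewrite g0 expr0n card_Fp //.
  have -> : (p.-1 == 0)%N = false by have := half_prime_gt0 p_prime pE; lia.
  by move/eqP; rewrite eq_sym oner_eq0.
have gn : g ^+ n.+1 != 1.
  have pm : p.-1 = m.*2 by rewrite pE.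
  by rewrite -(prim_order_dvd gp) card_Fp // pm dn.
set S := \sum_(x : K) _; have : S = g ^+ n.+1 * S.
  rewrite /S big_distrr /= (reindex_inj (mulfI g0)) /=.
  by apply: eq_bigr => x _; rewrite exprMn.
move/eqP; rewrite -subr_eq0 -{1}[S]mul1r -mulrBl mulf_eq0 subr_eq0 eq_sym (negbTE gn) /=.
by move=> /eqP e; exact: e.
Qed.

(** In F_p the number m equals -1/2, and C(2j, j) = (-4)^j C(-1/2, j). *)
Lemma central_bin_Fp j : (j <= m)%N -> ('C(2 * j, j))%:R = ('C(m, j))%:R * (-4) ^+ j :> K.
Proof.
elim: j => [|j IH] jm; first by rewrite !bin0 expr0 mulr1.
have {}IH := IH (ltnW jm).
have j0 : j.+1%:R != 0 :> K by apply: natr_Fp_neq0 => //; rewrite pE; lia.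
apply: (mulfI j0).
have e1 : (j.+1 * 'C(2 * j.+1, j.+1) = 2 * (2 * j + 1) * 'C(2 * j, j))%N.
  by rewrite mulnC central_bin_rec.
have e2 : (j.+1 * 'C(m, j.+1) = (m - j) * 'C(m, j))%N.
  by rewrite mul_bin_left.
rewrite -natrM e1 mulrA -natrM e2 !natrM natrB ?(ltnW jm) // IH.
rewrite natrD natrM exprS.
transitivity (('C(m, j))%:R * (-4) ^+ j * (2 * (2 * j%:R + 1)) : K); first by ring.
transitivity (('C(m, j))%:R * (-4) ^+ j * (- (2 * (2 * m%:R)) + 4 * j%:R) : K); last by ring.
by rewrite Fp_half; ring.
Qed.

Lemma bin_trinomial n k : (3 * k <= n)%N ->
  ('C(n, k) * 'C(n - k, 2 * k) = 'C(n, 3 * k) * 'C(3 * k, k))%N.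
Proof.
move=> kn.
have h1 := @bin_fact n k (ltac:(lia)); have h2 := @bin_fact (n - k) (2 * k) (ltac:(lia)).
have h3 := @bin_fact n (3 * k) kn; have h4 := @bin_fact (3 * k) k (ltac:(lia)).
have c0 : (0 < k`! * (2 * k)`! * (n - 3 * k)`!)%N by rewrite !muln_gt0 !fact_gt0.
apply/eqP; rewrite -(eqn_pmul2r c0); apply/eqP.
move: h1 h3; rewrite -h2 -h4.
rewrite (_ : n - k - 2 * k = n - 3 * k)%N; last by lia.
rewrite (_ : 3 * k - k = 2 * k)%N; last by lia.
by move=> h1 h3; transitivity n`!; [rewrite -h1 | rewrite -h3]; ring.
Qed.

Lemma ucoef_Fp k : (3 * k <= m)%N ->
  (ucoef k)%:R = ('C(m, k) * 'C(m - k, 2 * k))%:R * (-64) ^+ k :> K.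
Proof.
move=> km; rewrite bin_trinomial // /ucoef (_ : 6 * k = 2 * (3 * k))%N; last by lia.
rewrite !natrM central_bin_Fp // exprM; have -> : (-4) ^+ 3 = -64 :> K by ring.
by ring.
Qed.

(** Up to sign this is the Hasse invariant of y^2 = x^3 - 3x + 2t, as a polynomial in t. *)
Definition hasse_poly : {poly K} := \sum_(x : K) ((x ^+ 3 - 3 * x)%:P + 'X *+ 2) ^+ m.

(** After the shift x -> x + 1 the power sums single out the coefficient of
x^(p-1) in (x^2 (x + 3))^n. *)
Lemma sum_cubic_at_1 n : (n <= m)%N ->
  \sum_(x : K) ((x - 1) ^+ 2 * (x + 2)) ^+ n =
  if (3 * (m - n) <= m)%N then - ('C(n, 2 * (m - n)))%:R * 3 ^+ (m - 3 * (m - n)) else 0.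
Proof.
move=> nm; rewrite (reindex_inj (addIr 1)) /=.
transitivity (\sum_(x : K) \sum_(j < n.+1) ('C(n, j))%:R * 3 ^+ j * x ^+ (3 * n - j)).
  apply: eq_bigr => x _; rewrite addrK -addrA (_ : 1 + 2 = 3); last by ring.
  rewrite exprMn exprDn big_distrr /=; apply: eq_bigr => j _.
  have jn := ltn_ord j.
  rewrite -exprM (_ : 3 * n - j = 2 * n + (n - j))%N; last by lia.
  by rewrite exprD -mulr_natl; ring.
rewrite exchange_big /=.
under eq_bigr => j _ do rewrite -big_distrr sum_powers_Fp /=.
have m0 := half_prime_gt0 p_prime pE.
case: ifP => hn.
  have jn : (m - 3 * (m - n) < n.+1)%N by lia.
  rewrite (bigD1 (Ordinal jn)) //= big1 ?addr0 => [|j].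
    rewrite (_ : 3 * n - (m - 3 * (m - n)) = m.*2)%N; last by lia.
    rewrite dvdnn andbT double_gt0 m0 mulrN1 mulNr; congr (- (_%:R * _)).
    by rewrite -bin_sub; [congr ('C(_, _)); lia | lia].
  rewrite -val_eqE /= => hj; have jn' := ltn_ord j.
  case: ifP => //; last by rewrite mulr0.
  by case/andP => e0 /dvdnP[c e]; case: c e => [|[|c]] e; nia.
rewrite big1 // => j _; have jn' := ltn_ord j; case: ifP => //; last by rewrite mulr0.
by case/andP => e0 /dvdnP[c e]; case: c e => [|[|c]] e; nia.
Qed.

(** At t = 1 the cubic degenerates: x^3 - 3x + 2t = (x - 1)^2 (x + 2) - 2 (1 - t).
Expanding in powers of 1 - t and summing over x gives the coefficients u_k. *)
Lemma upoly_hasse (s : K) : (6 < p)%N -> 864 * s = 1 ->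
  3 ^+ m *: upoly_t s p = - hasse_poly.
Proof.
move=> p6 s864.
have three0 : 3 != 0 :> K by apply: natr_Fp_neq0 => //; lia.
pose Z : {poly K} := 1 - 'X.
have -> : hasse_poly = \sum_(k < m.+1) (('C(m, k))%:R * (-2) ^+ k *
    \sum_(x : K) ((x - 1) ^+ 2 * (x + 2)) ^+ (m - k)) *: Z ^+ k.
  rewrite /hasse_poly.
  transitivity (\sum_(x : K) \sum_(k < m.+1) (('C(m, k))%:R * (-2) ^+ k * ((x - 1) ^+ 2 * (x + 2)) ^+ (m - k)) *: Z ^+ k).
    apply: eq_bigr => x _.
    have -> : (x ^+ 3 - 3 * x)%:P + 'X *+ 2 = ((x - 1) ^+ 2 * (x + 2))%:P + (-2)%:P * Z.
      have -> : x ^+ 3 - 3 * x = (x - 1) ^+ 2 * (x + 2) + -2 by ring.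
      by rewrite polyCD /Z polyCN (rmorph_nat (@polyC K)); ring.
    rewrite exprDn; apply: eq_bigr => k _.
    rewrite exprMn -!rmorphXn /= -mul_polyC !polyCM (rmorph_nat (@polyC K)) -[LHS]mulr_natl.
    by ring.
  rewrite exchange_big; apply: eq_bigr => k _ /=.
  by rewrite -scaler_suml; congr (_ *: _); rewrite big_distrr.
have -> : upoly_t s p = \sum_(k < p) ((ucoef k)%:R * s ^+ k) *: Z ^+ k.
  rewrite /upoly_t /upoly poly_def rmorph_sum; apply: eq_bigr => k _ /=.
  rewrite comp_polyZ comp_Xn_poly exprMn -rmorphXn /= -mul_polyC -[RHS]mul_polyC polyCM mulrA.
  by [].
have mp : (m.+1 <= p)%N by rewrite pE; lia.
rewrite (big_ord_widen _ (fun k => (('C(m, k))%:R * (-2) ^+ k *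
    \sum_(x : K) ((x - 1) ^+ 2 * (x + 2)) ^+ (m - k)) *: Z ^+ k) mp) [in RHS]big_mkcond /=.
rewrite scaler_sumr -sumrN; apply: eq_bigr => k _.
rewrite scalerA; have [km|mk] := boolP (3 * k <= m)%N; last first.
  have -> : (ucoef k)%:R = 0 :> K.
    apply/eqP; rewrite natr_Fp_eq0; apply: dvdn_trans (dvdn_ucoef p_prime p6 (ltn_ord k) _).
      by rewrite expnS dvdn_mulr.
    by rewrite [X in (X <= _)%N]pE; lia.
  rewrite mul0r mulr0 scale0r; case: ifP => kp; last by rewrite oppr0.
  rewrite sum_cubic_at_1 ?leq_subr // subKn // (negbTE mk) mulr0 scale0r oppr0.
  by [].
have km' : (k < m.+1)%N by lia.
rewrite km' sum_cubic_at_1 ?leq_subr // subKn // km -scaleNr; congr (_ *: _).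
rewrite ucoef_Fp // natrM.
have s0 : 864 != 0 :> K.
  have : 864 * s != 0 by rewrite s864 oner_neq0.
  by rewrite mulf_eq0 negb_or => /andP[].
have -> : s ^+ k = 864 ^- k.
  by rewrite -exprVn; congr (_ ^+ _); apply: (mulfI s0); rewrite s864 mulfV.
have e3 : 3 ^+ m = 3 ^+ (m - 3 * k) * 27 ^+ k :> K.
  have -> : 27 = 3 ^+ 3 :> K by ring.
  by rewrite -exprM -exprD; congr (_ ^+ _); lia.
have e864 : 27 ^+ k * (-64) ^+ k * 864 ^- k = (-2) ^+ k :> K.
  rewrite -exprVn -!exprMn; congr (_ ^+ _); apply: (mulIf s0); rewrite mulfVK //; ring.
by rewrite e3 -e864; ring.
Qed.
End ModP.

(** * The Hasse invariant as an isobaric polynomial *)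

Section Scaling.
Variables (p m : nat).
Hypotheses (p_prime : prime p) (pE : p = m.*2.+1).
Local Notation K := 'F_p.
Local Notation eps := (odd m : nat).
Local Notation mu := m./2.

Lemma sum_cubic (r : nat) (a : K) : (r <= m)%N ->
  \sum_(x : K) (x ^+ 3 + a * x) ^+ r =
  if odd r then 0 else - ('C(r, m - r./2))%:R * a ^+ (r - (m - r./2)).
Proof.
move=> rm.
transitivity (\sum_(x : K) \sum_(i < r.+1) ('C(r, i))%:R * a ^+ i * x ^+ (3 * r - 2 * i)).
  apply: eq_bigr => x _; rewrite exprDn; apply: eq_bigr => i _; have ir := ltn_ord i.
  rewrite [(a * x) ^+ _]exprMn -exprM -[LHS]mulr_natl (_ : 3 * r - 2 * i = 3 * (r - i) + i)%N; last by lia.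
  by rewrite exprD; ring.
rewrite exchange_big /=.
under eq_bigr => i _ do rewrite -big_distrr (sum_powers_Fp p_prime pE) /=.
have m0 := half_prime_gt0 p_prime pE.
have out i : (i <= r)%N -> (3 * r - 2 * i != m.*2)%N ->
    ('C(r, i))%:R * a ^+ i * (if (0 < 3 * r - 2 * i)%N && (m.*2 %| 3 * r - 2 * i)%N then -1 else 0) = 0.
  move=> ir ne; case: ifP => //; last by rewrite mulr0.
  by case/andP => e0 /dvdnP[c e]; case: c e => [|[|c]] e; nia.
case: ifP => odr.
  by rewrite big1 // => i _; apply: out; have := ltn_ord i; lia.
have [hr|hr] := leqP (m - r./2) r; last first.
  by rewrite bin_small // oppr0 mul0r big1 // => i _; apply: out; have := ltn_ord i; lia.
have ir : (r - (m - r./2) < r.+1)%N by lia.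
rewrite (bigD1 (Ordinal ir)) //= big1 ?addr0 => [|i].
  rewrite (_ : 3 * r - 2 * (r - (m - r./2)) = m.*2)%N; last by lia.
  by rewrite double_gt0 m0 dvdnn /= mulrN1 mulNr bin_sub.
by rewrite -val_eqE /= => hi; apply: out; have := ltn_ord i; lia.
Qed.

Lemma sum_same_parity (V : nmodType) (F : nat -> V) (e : bool) n :
  (forall j, odd j != e -> F j = 0) ->
  \sum_(j < (e + n.*2).+1) F j = \sum_(l < n.+1) F (e + 2 * l)%N.
Proof.
move=> F0; elim: n => [|n IH].
  rewrite [RHS]big_ord_recr big_ord0 /= add0r muln0 !addn0.
  by case: e F0 => F0; rewrite !big_ord_recr big_ord0 /= ?add0r // F0 ?add0r.
transitivity (\sum_(l < n.+1) F (e + 2 * l)%N + F (e + 2 * n.+1)%N); last first.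
  by rewrite [RHS]big_ord_recr.
have -> : (e + 2 * n.+1 = (e + n.*2).+2)%N by lia.
rewrite -IH doubleS !addnS !big_ord_recr /=.
rewrite (F0 (e + n.*2).+1) ?addr0; last by rewrite /= oddD odd_double; case: (e).
by [].
Qed.

Definition hasse_coef l : nat := 'C(m, eps + 2 * l) * 'C(2 * (mu - l), m - (mu - l)).
Definition hasse_exp l : nat := (2 * (mu - l) - (m - (mu - l)))%N.

(** The Hasse invariant of y^2 = x^3 + a x + b is isobaric in a and b, and the powers of
b that occur have the parity of m.  Taking b to be a polynomial covers both the
family in t and a single curve. *)
Lemma sum_cubic_family (a : K) (b : {poly K}) :
  \sum_(x : K) ((x ^+ 3 + a * x)%:P + b) ^+ m =
  - \sum_(l < mu.+1) ((hasse_coef l)%:R * a ^+ hasse_exp l)%:P * b ^+ (eps + 2 * l).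
Proof.
pose F j : {poly K} := (('C(m, j))%:R * (if odd (m - j) then 0 else
   - ('C(m - j, m - (m - j)./2))%:R * a ^+ ((m - j) - (m - (m - j)./2))))%:P * b ^+ j.
transitivity (\sum_(j < m.+1) F j).
  transitivity (\sum_(x : K) \sum_(j < m.+1) (('C(m, j))%:R * (x ^+ 3 + a * x) ^+ (m - j))%:P * b ^+ j).
    apply: eq_bigr => x _; rewrite exprDn; apply: eq_bigr => j _.
    by rewrite polyCM (rmorph_nat (@polyC K)) rmorphXn /= -[LHS]mulr_natl mulrA.
  rewrite exchange_big; apply: eq_bigr => j _ /=.
  rewrite -big_distrl -rmorph_sum -big_distrr /= sum_cubic ?leq_subr //.
have par j : odd j != odd m -> F j = 0.
  have [jm|mj] := leqP j m; last by rewrite /F bin_small // mul0r polyC0 mul0r.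
  rewrite /F oddB //.
  by case: (odd j) (odd m) => -[] //= _; rewrite mulr0 polyC0 mul0r.
have := sum_same_parity mu par; rewrite odd_double_half => ->.
rewrite -sumrN; apply: eq_bigr => l _; have lm := ltn_ord l.
have ml : (m - (odd m + 2 * l) = 2 * (mu - l))%N by lia.
rewrite /F ml (mul2n (mu - l)) odd_double doubleK -mulNr; congr (_ * _).
by rewrite -polyCN /hasse_coef /hasse_exp (mul2n (mu - l)) natrM; congr (_ %:P); ring.
Qed.

(** The Hasse invariant of y^2 = x^3 - 3x + 2t is, up to sign, t^(odd m) times this
polynomial evaluated at t^2. *)
Definition hasse_even : {poly K} :=
  \sum_(l < mu.+1) ((hasse_coef l)%:R * (-3) ^+ hasse_exp l * 2 ^+ (eps + 2 * l)) *: 'X^l.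

Lemma hasse_poly_parity : hasse_poly p m = - ('X^eps * (hasse_even \Po 'X^2)).
Proof.
rewrite /hasse_poly; under eq_bigr => x _ do rewrite -mulNr.
rewrite sum_cubic_family; congr (- _).
rewrite /hasse_even rmorph_sum big_distrr; apply: eq_bigr => l _ /=.
have -> : 'X *+ 2 = (2 : K)%:P * 'X by rewrite (rmorph_nat (@polyC K)) mulr_natl.
rewrite comp_polyZ comp_Xn_poly -mul_polyC exprMn -rmorphXn /= [RHS]mulrCA -exprM -exprD.
by rewrite mulrA -polyCM.
Qed.

(** This is the twist by a square root of 10: 56^2 = 10^3 (2^2 * 98/125) and
-30 = 10 * -3. *)
Lemma hasse_value (t : K) : (6 < p)%N -> 125 * t = 98 ->
  \sum_(x : K) (x ^+ 3 + (-30) * x + 56) ^+ m = - (10 ^+ (mu - eps) * 28 ^+ eps * hasse_even.[t]).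
Proof.
move=> p6 t125; apply: polyC_inj.
rewrite rmorph_sum /=; under eq_bigr => x _ do rewrite rmorphXn /= polyCD.
rewrite sum_cubic_family polyCN; congr (- _).
under eq_bigr => l _ do rewrite -rmorphXn -polyCM.
rewrite -rmorph_sum /= /hasse_even horner_sum big_distrr /=; congr (_ %:P).
apply: eq_bigr => l _; rewrite hornerZ hornerXn.
have [h|h] := leqP (m - (mu - l)) (2 * (mu - l)); last first.
  by rewrite /hasse_coef (bin_small h) muln0 !mul0r mulr0.
have lm := ltn_ord l.
have e1 : (mu - eps = hasse_exp l + 3 * l)%N by rewrite /hasse_exp; lia.
rewrite e1 -[RHS]mulrA.
have -> : (-30 : K) ^+ hasse_exp l = (-3) ^+ hasse_exp l * 10 ^+ hasse_exp l.
  by rewrite -exprMn; congr (_ ^+ _); ring.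
have -> : (56 : K) ^+ (eps + 2 * l) = 2 ^+ (eps + 2 * l) * 28 ^+ eps * (10 ^+ (3 * l) * t ^+ l).
  have -> : 10 ^+ (3 * l) * t ^+ l = 28 ^+ (2 * l) :> K.
    rewrite !exprM -exprMn; congr (_ ^+ _); transitivity (8 * (125 * t)); first by ring.
    by rewrite t125; ring.
  by rewrite -mulrA -exprD -exprMn; congr (_ ^+ _); ring.
by rewrite (exprD 10); ring.
Qed.

(** The substitution x -> 3x + 4 turns x^3 - 30x + 56 into 27 x (x^2 + 4x + 2). *)
Lemma hasse_brewer : (6 < p)%N ->
  \sum_(x : K) (x ^+ 3 + (-30) * x + 56) ^+ m =
  27 ^+ m * (quad_char m (-1 : K) * brewer_sum K m)%:~R.
Proof.
move=> p6; have cK := cardFp_odd p_prime pE; have K2 := two_neq0_Fp p_prime pE.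
have three0 : 3 != 0 :> K.
  by apply: (natr_Fp_neq0 p_prime) => //; lia.
rewrite -(sum_chi_brewer_shift_opp cK K2) rmorph_sum big_distrr /=.
rewrite (reindex_inj (mulfI three0)) (reindex_inj (addIr (4 / 3))) /=.
apply: eq_bigr => x _.
rewrite chi_euler ?K2 -?cK ?expf_card //; last exact: half_prime_gt0 p_prime pE.
by rewrite -exprMn; congr (_ ^+ _); field.
Qed.

Lemma upoly_t_parts (s : K) : (6 < p)%N -> 864 * s = 1 ->
  3 ^+ m *: even_poly (upoly_t s p) = (if odd m then 0 else hasse_even) /\
  3 ^+ m *: odd_poly (upoly_t s p) = (if odd m then hasse_even else 0).
Proof.
move=> p6 s864; rewrite -even_polyZ -odd_polyZ (upoly_hasse p_prime pE p6 s864).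
rewrite hasse_poly_parity opprK; case: (odd m).
  by rewrite expr1 mulrC even_polyMX odd_polyMX odd_poly_compX2 even_poly_compX2 mul0r.
by rewrite expr0 mul1r even_poly_compX2 odd_poly_compX2.
Qed.

(** Since (3^m)^2 = (27^m)^2 = 1, all signs disappear in the squares. *)
Lemma upoly_t_value_sq (s t : K) : (6 < p)%N -> 864 * s = 1 -> 125 * t = 98 ->
  (even_poly (upoly_t s p)).[t] ^+ 2 + t * (odd_poly (upoly_t s p)).[t] ^+ 2 =
  10 ^+ m * (brewer_sum K m ^+ 2)%:~R.
Proof.
move=> p6 s864 t125; have [ev od] := upoly_t_parts p6 s864.
have three0 : 3 != 0 :> K by apply: (natr_Fp_neq0 p_prime) => //; lia.
have ten0 : 10 != 0 :> K.
  have -> : 10 = 2 * 5 :> K by ring.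
  by rewrite mulf_neq0 //; apply: (natr_Fp_neq0 p_prime) => //; lia.
have sq1 (x : K) : x != 0 -> (x ^+ m) ^+ 2 = 1.
  by move=> x0; rewrite -exprM muln2 (Fp_exp_pred p_prime pE).
have h : (27 ^+ m * (quad_char m (-1 : K) * brewer_sum K m)%:~R) ^+ 2 =
    (brewer_sum K m ^+ 2)%:~R :> K.
  rewrite exprMn sq1 ?mul1r; last first.
    have -> : 27 = 3 ^+ 3 :> K by ring.
    by rewrite expf_neq0.
  rewrite -rmorphXn exprMn /=; congr (_%:~R).
  by rewrite chi_sq ?mul1r ?oppr_eq0 ?oner_eq0 // -pE (Fp_exp_card p_prime).
rewrite -h -hasse_brewer // (hasse_value p6 t125) sqrrN.
have {}ev := congr1 (fun P => P.[t]) ev; have {}od := congr1 (fun P => P.[t]) od.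
rewrite !hornerZ in ev od.
have t784 : 784 = 10 ^+ 3 * t by transitivity (8 * (125 * t)); [rewrite t125 | ]; ring.
have k1 := sq1 _ three0; have k0 : 3 ^+ m != 0 :> K by rewrite expf_neq0.
have m1 : (0 < mu)%N by lia.
have mE : m = (odd m + 2 * mu)%N by rewrite mul2n odd_double_half.
have ten1 := Fp_exp_pred p_prime pE ten0.
move: ev od; case: (odd m) mE => mE ev od; move: ev => /eqP; last first.
  move=> /eqP ev; move: od => /eqP; rewrite horner0 mulf_eq0 (negbTE k0) => /eqP ->.
  rewrite expr0n mulr0 addr0 -ev subn0 mulr1.
  rewrite exprMn exprMn k1 mul1r mulrA -exprM -exprD.
  by rewrite (_ : m + mu * 2 = m.*2)%N ?ten1 ?mul1r //; lia.
rewrite horner0 mulf_eq0 (negbTE k0) => /eqP ->; rewrite expr0n add0r -od.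
have -> : 10 ^+ m * (10 ^+ (mu - true) * 28 ^+ true * (3 ^+ m * (odd_poly (upoly_t s p)).[t])) ^+ 2 =
   10 ^+ m * 10 ^+ (mu - 1) ^+ 2 * 784 * (3 ^+ m) ^+ 2 * (odd_poly (upoly_t s p)).[t] ^+ 2.
  by rewrite expr1; ring.
rewrite k1 mulr1 t784 (mulrA _ (10 ^+ 3)) -exprM -!exprD.
by rewrite (_ : m + (mu - 1) * 2 + 3 = m.*2)%N ?ten1 ?mul1r //; lia.
Qed.

(** The factor 28 of [hasse_value] is a unit unless p = 7. *)
Lemma upoly_t_vanish (s t : K) : (6 < p)%N -> 864 * s = 1 -> 125 * t = 98 ->
  brewer_sum K m = 0 ->
  (even_poly (upoly_t s p)).[t] = 0 /\ ((odd_poly (upoly_t s p)).[t] = 0 \/ p = 7).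
Proof.
move=> p6 s864 t125 B0; have [ev od] := upoly_t_parts p6 s864.
have three0 : 3 != 0 :> K by apply: (natr_Fp_neq0 p_prime) => //; lia.
have ten0 : 10 != 0 :> K.
  have -> : 10 = 2 * 5 :> K by ring.
  by rewrite mulf_neq0 //; apply: (natr_Fp_neq0 p_prime) => //; lia.
have k0 : 3 ^+ m != 0 :> K by rewrite expf_neq0.
have := hasse_value p6 t125; rewrite hasse_brewer // B0 mulr0 mulr0z mulr0 => /esym/eqP.
rewrite oppr_eq0 -mulrA mulf_eq0 expf_eq0 (negbTE ten0) andbF orFb mulf_eq0 expf_eq0 => h.
have {}ev := congr1 (fun P => P.[t]) ev; have {}od := congr1 (fun P => P.[t]) od.
rewrite !hornerZ in ev od.
have zero (y : K) : 3 ^+ m * y = 0 -> y = 0.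
  by move/eqP; rewrite mulf_eq0 (negbTE k0) => /eqP.
case/orP: h => [/andP[om h28]|/eqP A0]; last first.
  move: ev od; case: (odd m); rewrite A0 horner0 => ev od.
    by split; [apply: zero | left; apply: zero].
  by split; [apply: zero | left; apply: zero].
have om' : odd m by case: (odd m) om.
move: ev; rewrite om' horner0 => ev; split; first exact: zero.
right; have : (p %| 28)%N by rewrite -(natr_Fp_eq0 p_prime).
rewrite (_ : 28 = 2 ^ 2 * 7)%N // Euclid_dvdM // Euclid_dvdX // andbT !dvdn_prime2 //.
by case/orP => /eqP //; lia.
Qed.

End Scaling.

(** * From residues to rationals *)

(** The reduced denominator of N / D divides D. *)
Lemma plocal_frac (p D : nat) (N : int) : prime p -> coprime p D ->
  plocal p (N%:~R / D%:R).
Proof.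
move=> p_prime cD; have D0 : (0 < D)%N.
  by case: D cD => //; rewrite /coprime gcdn0 => /eqP p1; rewrite p1 in p_prime.
have D0' : D%:R != 0 :> rat by rewrite pnatr_eq0 -lt0n.
rewrite /plocal; set x := _ / _.
apply: coprime_dvdr cD.
have e : (numq x * D%:Z = N * denq x)%R.
  apply: (@intr_inj rat); rewrite !rmorphM /= numqE -mulrA [_ * D%:~R]mulrC mulrA.
  by rewrite -[D%:~R]/(D%:R) /x mulfVK.
rewrite -(@Gauss_dvdr _ `|numq x|%N) ?(coprime_sym `|denq x|%N) ?coprime_num_den //.
by rewrite -[D in (_ * D)%N]absz_nat -abszM e abszM dvdn_mull.
Qed.

Lemma eqmod_plocal_frac (p n D : nat) (N y : int) : prime p -> coprime p D ->
  (n%:Z %| N - y * D%:Z)%Z -> eqmod_plocal p n (N%:~R / D%:R) y%:~R.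
Proof.
move=> p_prime cD /dvdzP[c e].
have D0 : D%:R != 0 :> rat.
  rewrite pnatr_eq0; apply: contraTneq cD => ->; rewrite /coprime gcdn0.
  by apply: contraTneq p_prime => ->.
split; first exact: plocal_frac.
  by rewrite -[y%:~R]divr1; apply: (@plocal_frac p 1 y) => //; rewrite coprimen1.
exists (c%:~R / D%:R); first exact: plocal_frac.
apply: (mulIf D0); rewrite mulrBl !mulrA !mulfVK //.
have := congr1 (fun z : int => z%:~R : rat) e.
by rewrite rmorphB !rmorphM /= => ->; rewrite mulrC.
Qed.

(** The numerator of S over the common denominator D^(p-1), for D = 8000. *)
Definition binom_num (D p : nat) : nat := \sum_(k < p) acoef k * D ^ (p.-1 - k).

Lemma binom_num_value (R : comNzRingType) (D p : nat) (v : R) : (0 < p)%N -> D%:R * v = 1 ->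
  (binom_num D p)%:R = D%:R ^+ p.-1 * (apoly R p).[v].
Proof.
move=> p0 hv; rewrite /binom_num natr_sum /apoly horner_poly big_distrr; apply: eq_bigr => k _ /=.
have e : D%:R ^+ p.-1 = D%:R ^+ (p.-1 - k) * D%:R ^+ k :> R.
  by rewrite -exprD subnK //; have := ltn_ord k; lia.
rewrite e natrM natrX.
transitivity ((acoef k)%:R * D%:R ^+ (p.-1 - k) * (D%:R * v) ^+ k); last by rewrite exprMn; ring.
by rewrite hv expr1n mulr1.
Qed.

Lemma binom_sum_frac (D p : nat) : (0 < p)%N -> 20%:R ^+ 3 = D%:R :> rat ->
  binom_sum p = (binom_num D p)%:Z%:~R / (D ^ p.-1)%N%:R.
Proof.
move=> p0 h; have D0 : D%:R != 0 :> rat by rewrite -h expf_neq0 // pnatr_eq0.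
have -> : (binom_num D p)%:Z%:~R = (binom_num D p)%:R :> rat by [].
rewrite (binom_num_value p0 (mulfV D0)) natrX.
rewrite mulrAC (mulfV (expf_neq0 _ D0)) mul1r /apoly horner_poly /binom_sum big_mkord.
apply: eq_bigr => k _; rewrite exprM h exprVn; congr (_%:R / _).
by rewrite /acoef /ucoef; ring.
Qed.

Lemma upoly_t_map (R : comNzRingType) p (s : int) : 
  upoly_t (s%:~R : R) p = map_poly intr (upoly_t s p).
Proof.
rewrite /upoly_t map_comp_poly rmorphM rmorphB /= map_polyC map_polyX rmorph1.
congr (_ \Po _); apply/polyP => i; rewrite coef_map /upoly !coef_poly.
by case: ifP => _; rewrite ?natz.
Qed.

Lemma upoly_t_even_map (R : comNzRingType) p (s t : int) :
  (even_poly (upoly_t (s%:~R : R) p)).[t%:~R] = ((even_poly (upoly_t s p)).[t])%:~R.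
Proof.
rewrite -[RHS]horner_map upoly_t_map; congr (_.[_]).
by apply/polyP => i; rewrite coef_map !coef_even_poly coef_map.
Qed.

Lemma upoly_t_odd_map (R : comNzRingType) p (s t : int) :
  (odd_poly (upoly_t (s%:~R : R) p)).[t%:~R] = ((odd_poly (upoly_t s p)).[t])%:~R.
Proof.
rewrite -[RHS]horner_map upoly_t_map; congr (_.[_]).
by apply/polyP => i; rewrite coef_map !coef_odd_poly coef_map.
Qed.

Lemma natr_eq_mod (R : nzRingType) n a b : n%:R = 0 :> R -> a = b %[mod n] ->
  a%:R = b%:R :> R.
Proof.
move=> n0 ab; rewrite (divn_eq a n) (divn_eq b n) ab.
by rewrite !natrD !natrM n0 !mulr0 !add0r.
Qed.

Lemma natr_Zp_eq0 n a : (1 < n)%N -> (a%:R == 0 :> 'Z_n) = (n %| a)%N.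
Proof. by move=> n1; rewrite -val_eqE /= val_Zp_nat. Qed.

Lemma exists_div_mod n (a b : nat) : (1 < n)%N -> coprime n b ->
  exists x : nat, (b * x = a %[mod n])%N.
Proof.
move=> n1 cb; exists (nat_of_ord (a%:R / b%:R : 'Z_n)).
have : (b * nat_of_ord (a%:R / b%:R : 'Z_n))%:R = a%:R :> 'Z_n.
  by rewrite natrM natr_Zp mulrC divrK // unitZpE.
by move/(congr1 val); rewrite /= !val_Zp_nat.
Qed.

Lemma argument_value (R : comNzRingType) (s t : R) : 864 * s = 1 -> 125 * t = 98 ->
  20 ^+ 3 * (432 * s ^+ 2 * (1 - t)) = 1.
Proof.
move=> hs ht; transitivity (64 * (432 * s ^+ 2) * (125 - 125 * t)); first by ring.
rewrite ht; transitivity ((864 * s) ^+ 2); first by ring.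
by rewrite hs expr1n.
Qed.

(** * The two congruences *)

Section Main.
Variables (p m D : nat).
Hypotheses (p_prime : prime p) (p_gt6 : (6 < p)%N) (pE : p = m.*2.+1) (DE : D = (20 ^ 3)%N).
Local Notation K := 'F_p.

Lemma legendre_euler (a : int) : (legendre a p)%:~R = a%:~R ^+ m :> K.
Proof.
have m0 := half_prime_gt0 p_prime pE.
have cK := cardFp_odd p_prime pE; have K2 := two_neq0_Fp p_prime pE.
have dvdK (z : int) : (p %| z)%Z = (z%:~R == 0 :> K) := dvdz_pcharf (pchar_Fp p_prime) z.
rewrite /legendre dvdK; case: eqP => [->|/eqP a0]; first by rewrite expr0n gtn_eqF.
have eqK (x : nat) : ((x%:Z ^+ 2 == a %[mod p])%Z) = (x%:R ^+ 2 == a%:~R :> K).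
  by rewrite eqz_mod_dvd dvdK rmorphB rmorphXn /= subr_eq0.
case: ifP => [/existsP[x]|/negbT/existsPn nx].
  rewrite eqK => /eqP xa; rewrite -xa -exprM mul2n (Fp_exp_pred p_prime pE) //.
  by apply: contra a0 => /eqP x0; rewrite -xa x0 expr0n.
case: (@chi_values K m a%:~R a0) => ca.
  have [y ya] := chi_has_sqrt cK K2 ca.
  have yp : (y < p)%N by rewrite -[X in (_ < X)%N](Fp_cast p_prime) ltn_ord.
  by have := nx (Ordinal yp); rewrite eqK /= -ya natr_Zp eqxx.
rewrite -(chi_euler K2) ?ca //.
by rewrite -pE (Fp_exp_card p_prime).
Qed.

Lemma binom_num_parts (R : comNzRingType) (s t : int) : (p ^ 2)%:R = 0 :> R ->
  864 * s%:~R = 1 :> R -> 125 * t%:~R = 98 :> R ->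
  (binom_num D p)%:R = D%:R ^+ p.-1 * (((even_poly (upoly_t s p)).[t])%:~R ^+ 2 +
     t%:~R * ((odd_poly (upoly_t s p)).[t])%:~R ^+ 2) :> R.
Proof.
move=> p20 hs ht; have p0 := prime_gt0 p_prime.
rewrite -upoly_t_even_map -upoly_t_odd_map -(apoly_value t%:~R p_prime p_gt6 p20 hs).
by apply: binom_num_value => //; rewrite DE natrX (argument_value hs ht).
Qed.

(** Integers s and t that represent 1/864 and 98/125 modulo p^2, hence also modulo p:
they let one integer polynomial be reduced in both rings. *)
Lemma lifts : exists s t : nat, forall R : comNzRingType, (p ^ 2)%:R = 0 :> R ->
  864 * (s%:Z)%:~R = 1 :> R /\ 125 * (t%:Z)%:~R = 98 :> R.
Proof.
have n1 : (1 < p ^ 2)%N by rewrite -mulnn; nia.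
have c2 : coprime p 2 by rewrite prime_coprime // dvdn_prime2 //; lia.
have c3 : coprime p 3 by rewrite prime_coprime // dvdn_prime2 //; lia.
have c5 : coprime p 5 by rewrite prime_coprime // dvdn_prime2 //; lia.
have [s hs] : exists s, (864 * s = 1 %[mod p ^ 2])%N.
  apply: exists_div_mod => //; rewrite coprimeXl // (_ : 864 = 2 ^ 5 * 3 ^ 3)%N //.
  by rewrite coprimeMr !coprimeXr.
have [t ht] : exists t, (125 * t = 98 %[mod p ^ 2])%N.
  apply: exists_div_mod => //; rewrite coprimeXl // (_ : 125 = 5 ^ 3)%N //.
  by rewrite coprimeXr.
exists s, t => R p20; have := natr_eq_mod p20 hs; have := natr_eq_mod p20 ht.
by rewrite !natrM.
Qed.

Lemma coprime_denom : coprime p (D ^ p.-1).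
Proof.
have c2 : coprime p 2 by rewrite prime_coprime // dvdn_prime2 //; lia.
have c5 : coprime p 5 by rewrite prime_coprime // dvdn_prime2 //; lia.
by rewrite coprimeXr // DE coprimeXr // (_ : 20 = 2 ^ 2 * 5)%N // coprimeMr c5 coprimeXr.
Qed.

Lemma binom_sum_D : binom_sum p = (binom_num D p)%:Z%:~R / (D ^ p.-1)%N%:R.
Proof. by apply: binom_sum_frac; rewrite ?prime_gt0 // DE natrX. Qed.

Lemma Fp_sq0 : (p ^ 2)%:R = 0 :> K.
Proof. by rewrite natrX pchar_Fp_0 // expr0n. Qed.

Lemma binom_sum_supersingular : p = 5 %[mod 8] \/ p = 7 %[mod 8] ->
  eqmod_plocal p (p ^ 2)%N (binom_sum p) 0.
Proof.
move=> h; have B0 := brewer_sum_inert_eq0 p_prime pE h.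
have [s [t st]] := lifts.
have n1 : (1 < p ^ 2)%N by rewrite -mulnn; nia.
have [hs ht] := st K Fp_sq0.
have := upoly_t_vanish p_prime pE p_gt6 hs ht B0.
rewrite upoly_t_even_map upoly_t_odd_map; set e := _.[_]; set o := _.[_] => -[e0 o0].
have pA : (p ^ 2)%:R = 0 :> 'Z_(p ^ 2) by apply/eqP; rewrite natr_Zp_eq0.
have sq0 (z : int) : z%:~R = 0 :> K -> z%:~R ^+ 2 = 0 :> 'Z_(p ^ 2).
  move/eqP; rewrite -(dvdz_pcharf (pchar_Fp p_prime)) => /dvdzP[c ->].
  by rewrite rmorphM exprMn /= -[X in _ * X]natrX pA mulr0.
have [hsA htA] := st 'Z_(p ^ 2) pA.
have := binom_num_parts pA hsA htA; rewrite -/e -/o (sq0 _ e0) add0r.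
have -> : (t%:Z)%:~R * o%:~R ^+ 2 = 0 :> 'Z_(p ^ 2).
  case: o0 => [/sq0 ->|p7]; first by rewrite mulr0.
  (* Here 125 t = 98 is zero modulo 49. *)
  suff -> : (t%:Z)%:~R = 0 :> 'Z_(p ^ 2) by rewrite mul0r.
  have u : (125%:R : 'Z_(p ^ 2)) \is a GRing.unit.
    by rewrite unitZpE // p7.
  apply: (mulrI u); rewrite mulr0 [LHS]htA; apply/eqP.
  by rewrite (natr_Zp_eq0 98) // p7.
rewrite mulr0 => /eqP; rewrite natr_Zp_eq0 // => dN.
rewrite binom_sum_D -[0](mulr0z 1); apply: eqmod_plocal_frac => //; first exact: coprime_denom.
by rewrite mul0r subr0.
Qed.

Lemma binom_sum_ordinary (c d : int) : p = 1 %[mod 8] \/ p = 3 %[mod 8] ->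
  p%:Z = c ^+ 2 + 2 * d ^+ 2 ->
  eqmod_plocal p p (binom_sum p) (legendre (-5) p * (4 * c ^+ 2))%:~R.
Proof.
move=> h pcd; have [a [b [pab B]]] := brewer_sum_repr p_prime pE h.
have [s [t st]] := lifts; have [hs ht] := st K Fp_sq0.
rewrite -(repr_x2_2y2_uniq p_prime pab pcd) binom_sum_D; apply: eqmod_plocal_frac => //; first exact: coprime_denom.
rewrite (dvdz_pcharf (pchar_Fp p_prime)) rmorphB !rmorphM /= legendre_euler subr_eq0.
have -> : (binom_num D p)%:~R = (binom_num D p)%:R :> K by [].
have := binom_num_parts Fp_sq0 hs ht.
rewrite -upoly_t_even_map -upoly_t_odd_map (upoly_t_value_sq p_prime pE p_gt6 hs ht) => ->.
rewrite B.
have m2 : (-2) ^+ m = 1 :> K.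
  have K2 := two_neq0_Fp p_prime pE.
  rewrite -(chi_euler K2); last 2 first.
  - by rewrite -pE (Fp_exp_card p_prime).
  - exact: half_prime_gt0 p_prime pE.
  by rewrite (quad_char_m2 p_prime pE); case: h => ->.
have -> : 10 ^+ m = (-5)%:~R ^+ m :> K.
  have -> : 10 = (-5) * (-2) :> K by ring.
  by rewrite exprMn m2 mulr1 rmorphN.
have -> : (D ^ p.-1)%N%:Z%:~R = D%:R ^+ p.-1 :> K by exact: natrX.
by rewrite rmorphXn rmorphM /=; apply/eqP; ring.
Qed.

End Main.

Theorem theorem4p11 (p : nat) (p_prime : prime p) (p_gt5 : (5 < p)%N) :
  (p = 5 %[mod 8] \/ p = 7 %[mod 8] ->
     eqmod_plocal p (p ^ 2)%N (binom_sum p) 0)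
  /\
  (p = 1 %[mod 8] \/ p = 3 %[mod 8] ->
     (exists c d : int, p%:Z = c ^+ 2 + 2 * d ^+ 2)
     /\
     (forall c d : int, p%:Z = c ^+ 2 + 2 * d ^+ 2 ->
        eqmod_plocal p p (binom_sum p) (legendre (-5) p * (4 * c ^+ 2))%:~R)).
Proof.
have p_gt6 : (6 < p)%N by rewrite ltn_neqAle p_gt5 andbT; apply: contraTneq p_prime => <-.
have p_odd : odd p by case: (even_prime p_prime) => // p2; rewrite p2 in p_gt6.
have pE : p = (p./2).*2.+1 by have := odd_double_half p; rewrite p_odd.
have [D DE] : exists D, D = (20 ^ 3)%N by exists (20 ^ 3)%N.
split=> [h|h]; first exact: (binom_sum_supersingular p_prime p_gt6 pE DE).
split; first by have [c [d [e _]]] := brewer_sum_repr p_prime pE h; exists c, d.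
by move=> c d; apply: (binom_sum_ordinary p_prime p_gt6 pE DE).
Qed.
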